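(* Let $(\gamma_u)_{u\subseteq\mathbb{N}}$ be a family of non-negative real weights. The Toeplitz Monte Carlo (TMC) estimator $I^{\mathrm{TMC}}_{\rho_s}$ is (i) a weakly tractable algorithm if $$\lim_{s\to\infty}\frac1s\ln\left(\sum_{\ell=1}^s\ \max_{\substack{\emptyset\ne u\subseteq\{1,\ldots,s\}\\ \min_{j\in u}j=\ell}}\gamma_u\right)=0;$$ (ii) a polynomially tractable algorithm with the $\varepsilon^{-1}$-exponent $2$ if there exists $q>0$ such that $$\sup_{s=1,2,\ldots}\frac{1}{s^q}\sum_{\ell=1}^s\ \max_{\substack{\emptyset\ne u\subseteq\{1,\ldots,s\}\\ \min_{j\in u}j=\ell}}\gamma_u<\infty;$$ (iii) a strongly polynomially tractable algorithm with the $\varepsilon^{-1}$-exponent $2$ if $$\sum_{\ell=1}^\infty\ \sup_{\substack{\emptyset\ne u\subseteq\mathbb{N}\\ \min_{j\in u}j=\ell}}\gamma_u<\infty.$$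
   Context: Let $\mathbb{N}=\{1,2,\ldots\}$, let $\Omega\subseteq\mathbb{R}$ and let $\rho$ be a probability density function on $\Omega$. For $s\ge1$ put $\rho_s(\boldsymbol{x})=\prod_{j=1}^s\rho(x_j)$ for $\boldsymbol{x}=(x_1,\ldots,x_s)\in\Omega^s$, and $I_{\rho_s}(f)=\int_{\Omega^s}f(\boldsymbol{x})\rho_s(\boldsymbol{x})\,\mathrm{d}\boldsymbol{x}$. TMC estimator: let $x_1,\ldots,x_{N+s-1}$ be i.i.d. random variables in $\Omega$ with density $\rho$, set $\tilde{\boldsymbol{x}}_n=(x_{n+s-1},x_{n+s-2},\ldots,x_n)\in\Omega^s$ for $n=1,\ldots,N$, and define $I^{\mathrm{TMC}}_{\rho_s}(f;N)=\frac1N\sum_{n=1}^N f(\tilde{\boldsymbol{x}}_n)$. ANOVA decomposition: for $u\subseteq\{1,\ldots,s\}$ write $|u|$ for its cardinality, $-u=\{1,\ldots,s\}\setminus u$ and $\boldsymbol{x}_u=(x_j)_{j\in u}$. For $f\colon\Omega^s\to\mathbb{R}$ with $I_{\rho_s}(f^2)<\infty$, define recursively $f_\emptyset=I_{\rho_s}(f)$ and, for $\emptyset\ne u\subseteq\{1,\ldots,s\}$, $$f_u(\boldsymbol{x}_u)=\int_{\Omega^{s-|u|}}f(\boldsymbol{x})\rho_{s-|u|}(\boldsymbol{x}_{-u})\,\mathrm{d}\boldsymbol{x}_{-u}-\sum_{v\subsetneq u}f_v(\boldsymbol{x}_v),$$ so that $f(\boldsymbol{x})=\sum_{u\subseteq\{1,\ldots,s\}}f_u(\boldsymbol{x}_u)$.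 Weighted $L_2$ space: $\mathcal{F}_{s,\boldsymbol{\gamma}}$ is the space of square-integrable (i.e. $I_{\rho_s}(f^2)<\infty$) functions $f\colon\Omega^s\to\mathbb{R}$ with $\|f\|_{s,\boldsymbol{\gamma}}<\infty$, where $$\|f\|_{s,\boldsymbol{\gamma}}=\Big(\sum_{u\subseteq\{1,\ldots,s\}}\gamma_u^{-1}I_{\rho_s}(f_u^2)\Big)^{1/2}.$$ For any $u$ with $\gamma_u=0$ the corresponding ANOVA term $f_u$ is required to be $0$, and one formally sets $0/0=0$. Tractability: for a randomized algorithm $\mathrm{Alg}(f;N)$ using $N$ function evaluations of $f$ to estimate $I_{\rho_s}(f)$, set $$e^2(\mathrm{Alg},\mathcal{F}_{s,\boldsymbol{\gamma}})=\sup_{f\in\mathcal{F}_{s,\boldsymbol{\gamma}},\ \|f\|_{s,\boldsymbol{\gamma}}\le1}\mathbb{E}\left[(\mathrm{Alg}(f;N)-I_{\rho_s}(f))^2\right]$$ (this depends on $N$ and $s$; the expectation is over the randomness of the algorithm), and for $\varepsilon\in(0,1)$ $$N(\varepsilon,\mathrm{Alg})=\min\{N\in\mathbb{Z}_{>0}\mid e^2(\mathrm{Alg},\mathcal{F}_{s,\boldsymbol{\gamma}})\le\varepsilon^2\},$$ which depends on $\varepsilon$ and $s$. The algorithm is called: - weakly tractable if $\lim_{\varepsilon^{-1}+s\to\infty}\frac{\ln N(\varepsilon,\mathrm{Alg})}{\varepsilon^{-1}+s}=0$; - polynomially tractable if there exist non-negative constants $C,p,q$ such that $N(\varepsilon,\mathrm{Alg})\le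 C\varepsilon^{-p}s^q$ for all $s=1,2,\ldots$ and all $\varepsilon\in(0,1)$; $p$ and $q$ are then called the $\varepsilon^{-1}$-exponent and the $s$-exponent; - strongly polynomially tractable if it is polynomially tractable with $s$-exponent $q=0$. For the TMC estimator, $\mathrm{Alg}(f;N)=I^{\mathrm{TMC}}_{\rho_s}(f;N)$. *)

(* Defs.v *)
From HB Require Import structures.
From mathcomp Require Import all_boot all_order all_algebra.
From mathcomp Require Import all_classical all_reals all_analysis.
From mathcomp Require Import zify.
Set Implicit Arguments.
Unset Strict Implicit.
Unset Printing Implicit Defensive.
Import Order.TTheory GRing.Theory Num.Theory.
Import numFieldNormedType.Exports.

Local Open Scope classical_set_scope.
Local Open Scope ring_scope.

(* R^s is s.-tuple R with its product sigma-algebra (tnth x i is x_(i+1)).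
   The library has no s-dimensional Lebesgue measure; it is built here from
   R^(n+1) = R * R^n, see lebesgue_tuple_box below. *)
Definition tuple_cons (R : realType) n (p : measurableTypeR R * n.-tuple R) :
  n.+1.-tuple R := [the n.+1.-tuple R of (p.1 : R) :: p.2].

Fixpoint lebesgue_tuple (R : realType) (n : nat) :
    set (n.-tuple R) -> \bar R :=
  match n with
  | 0 => \d_([tuple] : 0.-tuple R)
  | m.+1 => pushforward (lebesgue_measure \x @lebesgue_tuple R m)%E
              (@tuple_cons R m)
  end.
Arguments lebesgue_tuple {R} n _.

Lemma measurable_tuple_cons (R : realType) n :
  measurable_fun setT (@tuple_cons R n).
Proof.
apply: (@measurable_cons _ _ _ R (fst : measurableTypeR R * n.-tuple R -> R)
  n (snd : measurableTypeR R * n.-tuple R -> n.-tuple R)).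
- exact: (@measurable_fst _ _ (measurableTypeR R) (n.-tuple R)).
- exact: (@measurable_snd _ _ (measurableTypeR R) (n.-tuple R)).
Qed.

Lemma lebesgue_tuple_subproof (R : realType) n :
  exists m : {sigma_finite_measure set (n.-tuple R) -> \bar R},
    lebesgue_tuple n = m :> (set (n.-tuple R) -> \bar R).
Proof.
elim: n => [|n [m mE]].
  by exists (\d_([tuple] : 0.-tuple R)).
pose M := @measure_function_pushforward__canonical__measure_function_Measure
  _ _ _ _ _ (lebesgue_measure \x m)%E _ (@measurable_tuple_cons R n).
have sf : sigma_finite setT M.
  have /sigma_finiteP[F [FT ndF Foo]] :=
    @sigma_finiteT _ _ _ (@lebesgue_measure R).
  have /sigma_finiteP[G [GT ndG Goo]] := sigma_finiteT m.
  pose g (x : n.+1.-tuple R) : measurableTypeR R * n.-tuple R :=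
    (thead x, [tuple of behead x]).
  have gK p : g (tuple_cons p) = p.
    by case: p => a y; congr pair; apply/val_inj.
  have mg : measurable_fun setT g.
    apply/measurable_fun_pair => /=; first exact: (measurable_tnth (T := R)).
    exact: (measurable_behead (T := R)).
  exists (fun k => g @^-1` (F k `*` G k)).
    apply/seteqP; split => // x _.
    have : [set: measurableTypeR R] (g x).1 by [].
    have : [set: n.-tuple R] (g x).2 by [].
    rewrite FT GT => -[k _ Gk] [l _ Fl]; exists (maxn k l) => //; split.
    - by move: Fl; apply/subsetPset/ndF/leq_maxr.
    - by move: Gk; apply/subsetPset/ndG/leq_maxl.
  move=> k; have [mF Fk] := Foo k; have [mG Gk] := Goo k; split.
    by rewrite -[X in measurable X]setTI; apply: mg => //; exact: measurableX.
  rewrite [M _](_ : _ = (lebesgue_measure \x m)%E (F k `*` G k)).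
    by rewrite product_measure1E// lte_mul_pinfty// ge0_fin_numE.
  rewrite /M/= /pushforward -comp_preimage (_ : g \o _ = id)//.
  by apply/funext => p; exact: gK.
pose sfM := Measure_isSigmaFinite.Build _ _ _ M sf.
pose SM : {sigma_finite_measure set (n.+1.-tuple R) -> \bar R} :=
  HB.pack (M : set _ -> _) M sfM.
by exists SM; rewrite /SM/= -mE.
Qed.

Section lebesgue_tuple_measure.
Context (R : realType) (n : nat).

Let leb0 : lebesgue_tuple n (set0 : set (n.-tuple R)) = 0%E.
Proof. by have [m ->] := lebesgue_tuple_subproof R n; exact: measure0. Qed.

Let leb_ge0 (A : set (n.-tuple R)) : (0 <= lebesgue_tuple n A)%E.
Proof. by have [m ->] := lebesgue_tuple_subproof R n; exact: measure_ge0. Qed.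

Let leb_sigma_additive : semi_sigma_additive (@lebesgue_tuple R n).
Proof.
have [m ->] := lebesgue_tuple_subproof R n.
exact: measure_semi_sigma_additive.
Qed.

HB.instance Definition _ := isMeasure.Build _ _ _ (@lebesgue_tuple R n)
  leb0 leb_ge0 leb_sigma_additive.

Let leb_sigma_finite : sigma_finite setT (@lebesgue_tuple R n).
Proof. by have [m ->] := lebesgue_tuple_subproof R n; exact: sigma_finiteT. Qed.

HB.instance Definition _ := Measure_isSigmaFinite.Build _ _ _
  (@lebesgue_tuple R n) leb_sigma_finite.
End lebesgue_tuple_measure.

Lemma lebesgue_tuple_box (R : realType) n (A : 'I_n -> set R) :
  (forall i, measurable (A i)) ->
  lebesgue_tuple n [set x | forall i, A i (tnth x i)] =
  (\prod_(i < n) lebesgue_measure (A i))%E.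
Proof.
elim: n A => [|n IH] A mA.
  rewrite big_ord0 /= diracE mem_set//=.
  by case.
rewrite big_ord_recl /= -IH// /pushforward.
rewrite -product_measure1E//=; first last.
  rewrite [X in measurable X](_ : _ =
    \bigcap_(i in [set: 'I_n]) (fun x => tnth x i) @^-1` A (lift ord0 i)).
    apply: fin_bigcap_measurable => // i _; rewrite -[X in measurable X]setTI.
    exact: measurable_tnth.
  by apply/seteqP; split => x /= Ax i => [_|]; exact: Ax.
  exact: (mA ord0).
congr (product_measure1 _ _ _); apply/seteqP; split => -[a y] /=.
  move=> Aay; split; first by have := Aay ord0; rewrite tnth0.
  by move=> i; have := Aay (lift ord0 i); rewrite tnthS.
by case=> Aa Ay i; case: (unliftP ord0 i) => [j ->|->]; rewrite ?tnthS ?tnth0.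
Qed.

Section weighted_anova_space.
Context (R : realType) (Omega : set R) (rho : R -> R).

Definition is_density :=
  [/\ measurable Omega, measurable_fun Omega rho,
      forall x, Omega x -> 0 <= rho x &
      (\int[lebesgue_measure]_(x in Omega) (rho x)%:E = 1)%E].

(* Omega^s and rho_s; functions on Omega^s are represented by functions on
   R^s, of which only the restriction to Omega^s is ever used. *)
Definition Omega_pow s : set (s.-tuple R) :=
  [set x | forall j, Omega (tnth x j)].

Definition rho_pow s (x : s.-tuple R) : R := \prod_(j < s) rho (tnth x j).

Definition I_rho s (f : s.-tuple R -> R) : \bar R :=
  (\int[lebesgue_tuple s]_(x in @Omega_pow s) (f x * rho_pow x)%:E)%E.

(* The point whose coordinates in u are those of x, and whose coordinates in
   -u are the entries of y, in increasing order of the index. *)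
Definition glue s (u : {set 'I_s}) (x : s.-tuple R) (y : #|~: u|.-tuple R) :
    s.-tuple R :=
  [tuple if i \in u then tnth x i else nth 0 y (index i (enum (~: u)))
   | i < s].

Definition marginal s (f : s.-tuple R -> R) (u : {set 'I_s}) (x : s.-tuple R)
  : R := fine (I_rho (fun y => f (@glue s u x y))).

(* f_u, as a function of the whole of x that depends on x_u only; n is fuel
   for the recursion on u, see anova_set0 and anovaE. *)
Fixpoint anova_rec n s (f : s.-tuple R -> R) (u : {set 'I_s})
    (x : s.-tuple R) : R :=
  if u == finset.set0 then fine (I_rho f) else
  if n is m.+1 then
    marginal f u x - \sum_(v : {set 'I_s} | v \proper u) anova_rec m f v x
  else 0.

Definition anova s (f : s.-tuple R -> R) (u : {set 'I_s}) :
  s.-tuple R -> R := anova_rec #|u| f u.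

Lemma anova_set0 s (f : s.-tuple R -> R) x :
  anova f finset.set0 x = fine (I_rho f).
Proof. by rewrite /anova cards0 /= eqxx. Qed.

Lemma anovaE s (f : s.-tuple R -> R) u x : u != finset.set0 ->
  anova f u x =
  marginal f u x - \sum_(v : {set 'I_s} | v \proper u) anova f v x.
Proof.
have recE n : forall v : {set 'I_s}, (#|v| <= n)%N ->
    anova_rec n f v x = anova f v x.
  rewrite /anova; elim: n {-2}n (leqnn n) => [|k IH] n.
    rewrite leqn0 => /eqP-> v; rewrite leqn0 cards_eq0 => /eqP->.
    by rewrite cards0.
  move=> nk v; case: n nk => [_|n nk].
    by rewrite leqn0 cards_eq0 => /eqP->; rewrite cards0.
  move=> vn /=; have [->|v0] := eqVneq v finset.set0.
    by rewrite cards0 /= eqxx.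
  have : (0 < #|v|)%N by rewrite card_gt0.
  case Ev : #|v| => [//|m] _ /=; rewrite (negPf v0); congr (_ - _).
  apply: eq_bigr => w /proper_card; rewrite Ev ltnS => wm.
  have mn : (m <= n)%N by rewrite -ltnS -Ev.
  by rewrite !IH ?(leq_trans wm)// (leq_trans mn).
move=> u0; rewrite {1}/anova.
have : (0 < #|u|)%N by rewrite card_gt0.
case Eu : #|u| => [//|m] _ /=; rewrite (negPf u0); congr (_ - _).
by apply: eq_bigr => v /proper_card; rewrite Eu ltnS => /recE.
Qed.

Definition square_integrable s (f : s.-tuple R -> R) : Prop :=
  measurable_fun (@Omega_pow s) f /\ (I_rho (fun x => (f x ^+ 2)%R) < +oo)%E.

Context (gamma : set nat -> R).

(* 'I_s stands for {1, ..., s}, so i : 'I_s is the index i.+1. *)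
Definition indices s (u : {set 'I_s}) : set nat :=
  [set (val i).+1 | i in [set` u]].

(* Here 0^-1 = 0: the terms with gamma_u = 0 contribute 0, as 0/0 = 0 demands
   of the functions in weighted_space, the only ones it is used for. *)
Definition anova_norm s (f : s.-tuple R -> R) : \bar R :=
  ((\sum_(u : {set 'I_s})
      ((gamma (indices u))^-1)%:E * I_rho (fun x => (anova f u x ^+ 2)%R))
   `^ 2^-1)%E.

(* f_u is determined up to a rho_s-null set only, hence the "almost every". *)
Definition weighted_space s : set (s.-tuple R -> R) :=
  [set f | [/\ square_integrable f, (anova_norm f < +oo)%E &
    forall u : {set 'I_s}, gamma (indices u) = 0 ->
      {ae lebesgue_tuple s, forall x,
         Omega_pow x -> 0 < rho_pow x -> anova f u x = 0}]].

(* max of gamma_u over the nonempty u included in {1, ..., s} with minimum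
   l.+1; a maximum of nonnegative numbers over a nonempty family. *)
Definition max_weight s (l : 'I_s) : R :=
  \big[Num.max/0]_(u : {set 'I_s} |
     (l \in u) && [forall j in u, (l <= j)%N]) gamma (indices u).

Definition sum_max_weight s : R := \sum_(l < s) max_weight l.

Definition sup_weight (l : nat) : \bar R :=
  ereal_sup [set (gamma u)%:E | u in
    [set u : set nat | u l /\ forall j, u j -> (l <= j)%N]].

End weighted_anova_space.

Section randomized_algorithms.
Context (R : realType) (Omega : set R) (rho : R -> R) (gamma : set nat -> R).
Context d (T : measurableType d) (P : probability T R).

(* alg s n f w: the estimate of the integral of f over Omega^s obtained from n
   evaluations of f under the random outcome w. *)
Implicit Type alg : forall s : nat, nat -> (s.-tuple R -> R) -> T -> R.

Definition sq_error alg s n : \bar R :=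
  ereal_sup [set ('E_P[fun w =>
      ((alg s n f w - fine (I_rho Omega rho f)) ^+ 2)%R])%E | f in
    [set f | weighted_space Omega rho gamma f /\
             (anova_norm Omega rho gamma f <= 1)%E]].

(* A minimum of positive integers, and +oo if there is no such n. *)
Definition complexity alg (eps : R) s : \bar R :=
  ereal_inf [set (n%:R)%:E | n in
    [set n | (0 < n)%N /\ (sq_error alg s n <= (eps ^+ 2)%:E)%E]].

Definition weakly_tractable alg : Prop :=
  forall delta : R, 0 < delta -> exists M : R,
    forall (s : nat) (eps : R), (0 < s)%N -> 0 < eps < 1 ->
      M < eps^-1 + s%:R ->
      (`| lne (complexity alg eps s) * ((eps^-1 + s%:R)^-1)%:E |
         < delta%:E)%E.

Definition polynomial_bound alg (p q : R) : Prop :=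
  exists2 C : R, 0 <= C &
    forall (s : nat) (eps : R), (0 < s)%N -> 0 < eps < 1 ->
      (complexity alg eps s <= (C * eps `^ (- p) * s%:R `^ q)%:E)%E.

(* p is the exponent of eps^-1. *)
Definition polynomially_tractable alg (p : R) : Prop :=
  0 <= p /\ exists2 q : R, 0 <= q & polynomial_bound alg p q.

Definition strongly_polynomially_tractable alg (p : R) : Prop :=
  0 <= p /\ polynomial_bound alg p 0.

End randomized_algorithms.

Section toeplitz_monte_carlo.
Context (R : realType) d (T : measurableType d) (P : probability T R).

Definition mutually_independent n (X : 'I_n -> {RV P >-> R}) : Prop :=
  forall (J : {set 'I_n}) (A : 'I_n -> set R),
    (forall i, measurable (A i)) ->
    P (\bigcap_(i in [set` J]) X i @^-1` A i) =
    (\prod_(i in J) P (X i @^-1` A i))%E.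

Definition iid_sample (Omega : set R) (rho : R -> R) n
    (X : 'I_n -> {RV P >-> R}) : Prop :=
  [/\ forall i w, Omega (X i w),
      forall i (A : set R), measurable A ->
        (distribution P (X i) A =
         \int[lebesgue_measure]_(x in Omega `&` A) (rho x)%:E)%E &
      mutually_independent X].

Lemma toeplitz_subproof s n (i : 'I_n) (j : 'I_s) :
  (i + (s - 1 - j) < n + s - 1)%N.
Proof. by have := ltn_ord i; have := ltn_ord j; lia. Qed.

(* With all indices starting from 0: coordinate j of the i-th point is the
   sample value of index i + s - 1 - j. *)
Definition toeplitz_point s n (z : 'I_(n + s - 1) -> R) (i : 'I_n) :
    s.-tuple R :=
  [tuple z (Ordinal (toeplitz_subproof i j)) | j < s].

Definition tmc (X : forall s n, 'I_(n + s - 1) -> {RV P >-> R}) s n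
    (f : s.-tuple R -> R) (w : T) : R :=
  n%:R^-1 * \sum_(i < n) f (toeplitz_point (fun k => X s n k w) i).

End toeplitz_monte_carlo.

(* Main.v *)
Require Import Defs.
From HB Require Import structures.
From mathcomp Require Import all_boot all_order all_algebra.
From mathcomp Require Import all_classical all_reals all_analysis.
From mathcomp Require Import measurable_realfun.
From mathcomp Require Import zify ring lra.
Import Order.TTheory GRing.Theory Num.Theory.
Import numFieldNormedType.Exports.
Local Open Scope classical_set_scope.
Local Open Scope ring_scope.

(** All three claims follow from one error bound: with
    S = sum_max_weight gamma s, the worst-case mean square error of the
    estimator over the unit ball is at most S / N ([sq_error_tmc_le]).  Then
    floor (S / eps^2) + 1 points suffice, hence at most 1 + S / eps^2, and the
    hypotheses (i), (ii), (iii) say that S grows subexponentially, grows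
    polynomially, or stays bounded in s.

    To bound the error, expand f into its ANOVA terms at each of the N points:
    N times the error is the sum over i < N and nonempty u of f_u (x_i), where
    x_i is the i-th point.  The function f_u (x_i) depends on the sample values
    whose indices form the image of u under the map j |-> i + s - 1 - j, and its
    mean over any one of these values is 0.  Hence two terms (i, u) and (i', v)
    with different images are orthogonal ([inner_components0]): one of the
    images contains an index k that the other one misses, and averaging over
    the k-th sample value kills the product.  Terms with equal images are called
    aligned.  For those, the inequality of arithmetic and geometric means, with
    weights gamma_u and gamma_v, gives
      2 |E (f_u (x_i) f_v (x_i'))|
        <= (gamma_v / gamma_u) ||f_u||^2 + (gamma_u / gamma_v) ||f_v||^2,
    so that E (N error)^2 is at most the sum over (i, u) of
    ||f_u||^2 / gamma_u times the sum of gamma_v over the (i', v) aligned with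
    (i, u) ([inner_sum_le]).  All these v are translates of u with different
    least elements, so the inner sum is at most S ([sum_aligned_le]); the outer
    one is at most N ||f||^2, whence E error^2 <= S / N.

    The measure theory behind the orthogonality takes place on the laws mu n of
    n independent variables of density rho, which are probabilities on n-tuples
    characterized by their values on boxes ([box_unique]).  The average of f
    given the coordinates in u is written as an integral over a full
    independent copy y of the point, of which only the coordinates outside u
    matter ([cond_mean]).  The one fact required is then that exchanging one
    coordinate of the sample with one coordinate of y preserves their joint law
    ([exchange_law]): against a function that ignores the j-th coordinate, the
    averages of f given u and given u minus j have the same integral
    ([inner_cond_mean_drop]), and induction on u transfers this to the ANOVA
    terms ([inner_component0]).  Finally, functions are only relevant on
    Omega^s; composing them with a measurable retraction onto Omega^s makes
    them functions on the whole of R^s without changing any integral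
    ([I_rhoE]). *)

Set Implicit Arguments.
Unset Strict Implicit.
Unset Printing Implicit Defensive.

(** * Image measures and measures determined by boxes *)

Section transport.
Context d1 d2 (X : measurableType d1) (Y : measurableType d2) (R : realType).
Variables (P : {measure set X -> \bar R}) (Q : {measure set Y -> \bar R}).
Variables (phi : X -> Y) (mphi : measurable_fun setT phi).
Hypothesis lawE : forall A, measurable A -> P (phi @^-1` A) = Q A.

Lemma ge0_integral_transport (h : Y -> \bar R) :
  measurable_fun setT h -> (forall y, 0 <= h y)%E ->
  (\int[Q]_y h y = \int[P]_x h (phi x))%E.
Proof.
move=> mh h0.
pose M := measure_function_pushforward__canonical__measure_function_Measure P mphi.
rewrite (@eq_measure_integral _ _ _ _ M); last first.
  by move=> A mA _; rewrite -lawE.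
by rewrite ge0_integral_pushforward.
Qed.

(** Without integrability: the integral is by definition the difference of the
    integrals of the positive and negative parts, which are transported
    separately. *)
Lemma integral_transport (h : Y -> \bar R) :
  measurable_fun setT h -> (\int[Q]_y h y = \int[P]_x h (phi x))%E.
Proof.
move=> mh; rewrite integralE [RHS]integralE.
rewrite !ge0_integral_transport//; last 2 first.
- exact: measurable_funeneg.
- exact: measurable_funepos.
by congr (_ - _)%E; apply: eq_integral => x _; rewrite unlock.
Qed.

Lemma integrable_transport (h : Y -> \bar R) :
  Q.-integrable setT h -> P.-integrable setT (h \o phi).
Proof.
move=> /integrableP[mh hoo]; apply/integrableP; split.
  exact: measurableT_comp.
rewrite -(ge0_integral_transport (h := fun y => `|h y|%E))//.
exact: measurableT_comp.
Qed.
End transport.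

Section boxes.
Context (R : realType).
Implicit Types n : nat.

Definition box n (A : 'I_n -> set R) : set (n.-tuple R) :=
  [set x | forall i, A i (tnth x i)].

Definition boxes n : set (set (n.-tuple R)) :=
  [set box A | A in [set A | forall i, measurable (A i)]].

Lemma measurable_box n (A : 'I_n -> set R) :
  (forall i, measurable (A i)) -> measurable (box A).
Proof.
move=> mA; rewrite [X in measurable X](_ : _ =
    \bigcap_(i in [set: 'I_n]) (fun x => tnth x i) @^-1` A i).
  apply: fin_bigcap_measurable => // i _; rewrite -[X in measurable X]setTI.
  exact: measurable_tnth.
by apply/seteqP; split => x /= Ax i => [_|]; exact: Ax.
Qed.

Lemma measurable_tuple_boxes n :
  @measurable _ (n.-tuple R) = <<s @boxes n >>.
Proof.
apply/seteqP; split.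
  apply: smallest_sub; first exact: smallest_sigma_algebra.
  rewrite -bigcup_seq => B [i _ [C mC <-]].
  apply: sub_sigma_algebra.
  exists (fun j => if j == i then C else setT).
    by move=> j; case: ifP.
  rewrite setTI; apply/seteqP; split => x /=.
    by move=> /(_ i); rewrite eqxx.
  by move=> Cx j; case: eqP => [->|].
apply: smallest_sub; first exact: sigma_algebra_measurable.
by move=> _ [A mA <-]; exact: measurable_box.
Qed.

Lemma boxes_setI_closed n : setI_closed (@boxes n).
Proof.
move=> _ _ [A mA <-] [B mB <-]; exists (fun i => A i `&` B i).
  by move=> i; exact: measurableI.
apply/seteqP; split => x /=.
  by move=> AB; split => i; have [] := AB i.
by case=> Ax Bx i; split.
Qed.

Lemma boxT n : box (fun=> setT : set R) = [set: n.-tuple R].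
Proof. by apply/seteqP; split. Qed.

(** Boxes form a pi-system that generates the sigma-algebra of tuples. *)
Lemma box_unique n (m1 m2 : {measure set (n.-tuple R) -> \bar R}) :
  (m1 setT < +oo)%E ->
  (forall A, (forall i, measurable (A i)) -> m1 (box A) = m2 (box A)) ->
  forall A, measurable A -> m1 A = m2 A.
Proof.
move=> m1oo m12 A mA.
apply: (measure_unique (@boxes n) (fun=> setT)) => //.
- exact: measurable_tuple_boxes.
- exact: boxes_setI_closed.
- by move=> _; exists (fun=> setT) => //; exact: boxT.
- by rewrite bigcup_const.
- by move=> _ [B mB <-]; exact: m12.
Qed.

(** Fix one of the two factors and apply [box_unique] to the other one: first
    with a box B as second factor, then with any measurable first factor A. *)
Lemma box_prod_unique n p
    (m1 m2 : {measure set (n.-tuple R * p.-tuple R)%type -> \bar R}) :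
  (m1 setT < +oo)%E ->
  (forall A B, (forall i, measurable (A i)) -> (forall i, measurable (B i)) ->
    m1 (box A `*` box B) = m2 (box A `*` box B)) ->
  forall A B, measurable A -> measurable B -> m1 (A `*` B) = m2 (A `*` B).
Proof.
move=> m1oo m12.
have le1 A : measurable A -> (m1 A < +oo)%E.
  by move=> mA; apply: le_lt_trans m1oo; apply: le_measure; rewrite ?inE.
have step B : (forall i, measurable (B i)) ->
    forall A, measurable A -> m1 (A `*` box B) = m2 (A `*` box B).
  move=> mB.
  have mTB : measurable ([set: n.-tuple R] `*` box B).
    by apply: measurableX => //; exact: measurable_box.
  pose q (m : {measure set (n.-tuple R * p.-tuple R)%type -> \bar R}) :=
    measure_function_pushforward__canonical__measure_function_Measure
    (mrestr m mTB) (@measurable_fst _ _ (n.-tuple R) (p.-tuple R)).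
  have qE m A : q m A = m (A `*` box B).
    rewrite /q /= /pushforward /mrestr; congr (m _).
    by apply/seteqP; split => -[x y] /= [] // Ax [].
  move=> A mA; rewrite -!qE.
  apply: box_unique => //.
    by rewrite qE; apply: le1.
  by move=> C mC; rewrite !qE; exact: m12.
move=> A B mA mB.
have mAT : measurable (A `*` [set: p.-tuple R]) by exact: measurableX.
pose q (m : {measure set (n.-tuple R * p.-tuple R)%type -> \bar R}) :=
  measure_function_pushforward__canonical__measure_function_Measure
  (mrestr m mAT) (@measurable_snd _ _ (n.-tuple R) (p.-tuple R)).
have qE m C : q m C = m (A `*` C).
  rewrite /q /= /pushforward /mrestr; congr (m _).
  by apply/seteqP; split => -[x y] /= [] // Cx [].
rewrite -!qE; apply: box_unique => //.
  by rewrite qE; apply: le1; exact: measurableX.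
by move=> C mC; rewrite !qE; exact: step.
Qed.

End boxes.

(** * Laws of tuples of independent variables *)

Section tuple_maps.
Context (R : realType).

Definition select m n (sigma : 'I_n -> 'I_m) (x : m.-tuple R) : n.-tuple R :=
  [tuple tnth x (sigma i) | i < n].

Definition mix n (u : {set 'I_n}) (x y : n.-tuple R) : n.-tuple R :=
  [tuple if i \in u then tnth x i else tnth y i | i < n].

Definition update n (x : n.-tuple R) (k : 'I_n) (a : R) : n.-tuple R :=
  [tuple if i == k then a else tnth x i | i < n].

Definition exchange m n (k : 'I_m) (j : 'I_n) (p : m.-tuple R * n.-tuple R) :=
  (update p.1 k (tnth p.2 j), update p.2 j (tnth p.1 k)).

Lemma measurable_tupleP d (T : measurableType d) n (f : T -> n.-tuple R) :
  (forall i, measurable_fun setT (fun x => tnth (f x) i)) ->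
  measurable_fun setT f.
Proof. by move=> mf; apply/measurable_fun_tnthP. Qed.

Lemma measurable_select m n (sigma : 'I_n -> 'I_m) : measurable_fun setT (select sigma).
Proof.
apply: measurable_tupleP => i.
under eq_fun do rewrite tnth_mktuple.
exact: measurable_tnth.
Qed.

Lemma measurable_tnth1 m n i :
  measurable_fun setT (fun p : m.-tuple R * n.-tuple R => tnth p.1 i).
Proof.
apply: (measurableT_comp (f := fun x : m.-tuple R => tnth x i)) => //.
exact: measurable_tnth.
Qed.

Lemma measurable_tnth2 m n i :
  measurable_fun setT (fun p : m.-tuple R * n.-tuple R => tnth p.2 i).
Proof.
apply: (measurableT_comp (f := fun x : n.-tuple R => tnth x i)) => //.
exact: measurable_tnth.
Qed.

Lemma measurable_mix m n (tau : 'I_n -> 'I_m) u :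
  measurable_fun setT
    (fun p : m.-tuple R * n.-tuple R => mix u (select tau p.1) p.2).
Proof.
apply: measurable_tupleP => i.
under eq_fun do rewrite !tnth_mktuple.
by case: (i \in u); [exact: measurable_tnth1|exact: measurable_tnth2].
Qed.

Lemma measurable_exchange m n (k : 'I_m) (j : 'I_n) : measurable_fun setT (exchange k j).
Proof.
apply/measurable_fun_pair => /=; apply: measurable_tupleP => i;
  under eq_fun do rewrite !tnth_mktuple;
  case: eqP => _; solve [exact: measurable_tnth1|exact: measurable_tnth2].
Qed.

End tuple_maps.

Section product_probability.
Context d1 d2 (T1 : measurableType d1) (T2 : measurableType d2) (R : realType).
Context (P : probability T1 R) (Q : probability T2 R).

Lemma product_probability_setT : (P \x Q)%E setT = 1%E.
Proof.
rewrite -setXTT product_measure1E//= -[RHS]mule1.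
by rewrite -{1}(probability_setT P) -(probability_setT Q).
Qed.

Definition product_probability : probability (T1 * T2)%type R :=
  HB.pack (P \x Q)%E
    (Measure_isProbability.Build _ _ _ (P \x Q)%E product_probability_setT).

End product_probability.

(** mu n is the n-th power of a probability nu on R: only the values on boxes
    are given, and they determine mu n. *)
Section power_measure.
Context (R : realType) (nu : set R -> \bar R).
Context (mu : forall n, probability (n.-tuple R) R).
Hypothesis nuT : nu setT = 1%E.
Hypothesis mu_box : forall n (A : 'I_n -> set R),
  (forall i, measurable (A i)) -> mu n (box A) = (\prod_(i < n) nu (A i))%E.

Lemma tuple_law d (T : measurableType d) (P : probability T R) n
    (f : T -> n.-tuple R) : measurable_fun setT f ->
  (forall A : 'I_n -> set R, (forall i, measurable (A i)) ->
    P (f @^-1` box A) = (\prod_(i < n) nu (A i))%E) ->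
  forall A, measurable A -> P (f @^-1` A) = mu n A.
Proof.
move=> mf fE.
pose M := measure_function_pushforward__canonical__measure_function_Measure P mf.
apply: (@box_unique _ _ M) => /=.
  by rewrite /pushforward preimage_setT probability_setT ltry.
by move=> A mA; rewrite mu_box// -fE.
Qed.

Lemma select_law m n (sigma : 'I_n -> 'I_m) : injective sigma ->
  forall A, measurable A -> mu m (select sigma @^-1` A) = mu n A.
Proof.
move=> sI; apply: tuple_law; first exact: measurable_select.
move=> A mA.
(* the constraint on the k-th entry of x: A i if k = sigma i, and none for k
   outside the image of sigma *)
pose B k := [set x | forall i, sigma i = k -> A i x].
have BE i : B (sigma i) = A i.
  apply/seteqP; split => x /=; first by apply.
  by move=> Aix j /sI ->.
have BT k : k \notin (sigma @: 'I_n)%SET -> B k = setT.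
  move=> kn; apply/seteqP; split => // x _ i ik.
  by move/negP: kn; case; rewrite -ik; apply: imset_f.
have mB k : measurable (B k).
  have [/imsetP[i _ ->]|/BT->//] := boolP (k \in (sigma @: 'I_n)%SET).
  by rewrite BE.
have -> : select sigma @^-1` box A = box B.
  apply/seteqP; split => x /= xA i.
    by move=> j <-; have := xA j; rewrite tnth_mktuple.
  by rewrite tnth_mktuple; exact: xA.
rewrite mu_box// (bigID (mem (sigma @: 'I_n)%SET))/=.
rewrite [X in (_ * X)%E]big1 ?mule1; last by move=> k /BT->.
rewrite big_imset; last by move=> i j _ _; exact: sI.
by apply: eq_bigr => i _; rewrite BE.
Qed.

(** Distinct coordinates of z and the remaining coordinates of an independent y
    make up a family of independent variables of law nu again. *)
Lemma mix_law m n (tau : 'I_n -> 'I_m) u : injective tau ->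
  forall A, measurable A ->
  product_probability (mu m) (mu n)
    ((fun p => mix u (select tau p.1) p.2) @^-1` A) = mu n A.
Proof.
move=> tI; apply: tuple_law; first exact: measurable_mix.
move=> A mA.
pose A1 i := if i \in u then A i else setT.
pose A2 i := if i \in u then setT else A i.
have mA1 i : measurable (A1 i) by rewrite /A1; case: ifP.
have mA2 i : measurable (A2 i) by rewrite /A2; case: ifP.
rewrite [X in _ X = _](_ : _ =
    (select tau @^-1` box A1) `*` box A2); last first.
  apply/seteqP; split => -[z y] /=.
    move=> xA; split => i; have := xA i; rewrite /A1 /A2 !tnth_mktuple;
    by case: ifP.
  case=> zA yA i; have := zA i; have := yA i.
  by rewrite /A1 /A2 !tnth_mktuple; case: ifP.
have mS : measurable (select tau @^-1` box A1).
  rewrite -[X in measurable X]setTI; apply: measurable_select => //.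
  exact: measurable_box.
transitivity (mu m (select tau @^-1` box A1) * mu n (box A2))%E.
  by apply: product_measure1E => //; exact: measurable_box.
have := select_law tI (measurable_box mA1) => /= ->.
rewrite !mu_box// -big_split/=; apply: eq_bigr => i _.
by rewrite /A1 /A2; case: ifP => _; rewrite nuT ?mule1 ?mul1e.
Qed.

(** The joint law is a product of identical factors, so it is invariant under
    any transposition of two of them. *)
Lemma exchange_law m n (k : 'I_m) (j : 'I_n) :
  forall C, measurable C ->
  product_probability (mu m) (mu n) (exchange k j @^-1` C) =
  product_probability (mu m) (mu n) C.
Proof.
pose M := measure_function_pushforward__canonical__measure_function_Measure
  (product_probability (mu m) (mu n)) (measurable_exchange k j).
move=> C mC; apply/esym; apply: (@product_measure_unique _ _ _ _ _ _ _ M) => //.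
move=> A B mA mB; rewrite -product_measure1E//.
apply: box_prod_unique => //=.
  by rewrite /pushforward preimage_setT product_probability_setT ltry.
move=> {mA mB C mC}A {}B mA mB.
rewrite /pushforward.
pose A' i := if i == k then B j else A i.
pose B' i := if i == j then A k else B i.
have mA' i : measurable (A' i) by rewrite /A'; case: ifP.
have mB' i : measurable (B' i) by rewrite /B'; case: ifP.
rewrite [X in _ X = _](_ : _ = box A' `*` box B'); last first.
  apply/seteqP; split => -[z y] /= [zA yB].
    split => i.
      have [->|ik] := eqVneq i k; rewrite /A'.
        by rewrite eqxx; have := yB j; rewrite !tnth_mktuple eqxx.
      by rewrite (negbTE ik); have := zA i; rewrite !tnth_mktuple (negbTE ik).
    have [->|ij] := eqVneq i j; rewrite /B'.
      by rewrite eqxx; have := zA k; rewrite !tnth_mktuple eqxx.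
    by rewrite (negbTE ij); have := yB i; rewrite !tnth_mktuple (negbTE ij).
  split => i; rewrite !tnth_mktuple.
    have [->|ik] := eqVneq i k; first by have := yB j; rewrite /B' eqxx.
    by have := zA i; rewrite /A' (negbTE ik).
  have [->|ij] := eqVneq i j; first by have := zA k; rewrite /A' eqxx.
  by have := yB i; rewrite /B' (negbTE ij).
transitivity (mu m (box A') * mu n (box B'))%E.
  by apply: product_measure1E; exact: measurable_box.
transitivity (mu m (box A) * mu n (box B))%E; last first.
  by apply/esym/product_measure1E; exact: measurable_box.
rewrite !mu_box// [in LHS](bigD1 k)//= [X in (_ * X = _)%E](bigD1 j)//=.
rewrite [in RHS](bigD1 k)//= [X in (_ = _ * X)%E](bigD1 j)//=.
rewrite {1}/A' eqxx.
rewrite (eq_bigr (fun i => nu (A i))); last first.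
  by move=> i ik; rewrite /A' (negbTE ik).
rewrite [X in (_ * (_ * X) = _)%E](eq_bigr (fun i => nu (B i))); last first.
  by move=> i ij; rewrite /B' (negbTE ij).
rewrite /B' eqxx muleACA [RHS]muleACA; congr (_ * _)%E; exact: muleC.
Qed.

End power_measure.

(** * Square integrable functions *)

Section square_integrable_functions.
Context d (T : measurableType d) (R : realType) (P : probability T R).
Implicit Types f g : T -> R.

Definition L2 f :=
  measurable_fun setT f /\ (\int[P]_x ((f x) ^+ 2)%:E < +oo)%E.

Definition inner f g : R := \int[P]_x (f x * g x).

Lemma L2_sqr_integrable f : L2 f -> P.-integrable setT (fun x => ((f x) ^+ 2)%:E).
Proof.
move=> [mf foo]; apply/integrableP; split.
  by apply/measurable_EFinP; exact: measurable_funX.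
by under eq_integral do rewrite gee0_abs ?lee_fin ?sqr_ge0//.
Qed.

Lemma integrable_L2 f : measurable_fun setT f ->
  P.-integrable setT (fun x => ((f x) ^+ 2)%:E) -> L2 f.
Proof. by move=> mf fi; split => //; exact: integrable_lty fi. Qed.

Lemma L2_mul_integrable f g :
  L2 f -> L2 g -> P.-integrable setT (fun x => (f x * g x)%:E).
Proof.
move=> f2 g2.
apply: (le_integrable _ _ _ (integrableD _ (L2_sqr_integrable f2)
  (L2_sqr_integrable g2))) => //.
  by apply/measurable_EFinP; apply: measurable_funM; [case: f2|case: g2].
move=> x _; rewrite -EFinD !abse_EFin lee_fin [leRHS]ger0_norm ?addr_ge0 ?sqr_ge0//.
by rewrite ler_norml; apply/andP; split; nra.
Qed.

Lemma L2_cst c : L2 (fun=> c).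
Proof.
split; first exact: measurable_cst.
rewrite integral_cst// [X in (_ * X)%E](_ : _ = 1%E) ?mule1 ?ltry//.
exact: probability_setT.
Qed.

Lemma L2_integrable f : L2 f -> P.-integrable setT (fun x => (f x)%:E).
Proof.
move=> /(L2_mul_integrable (L2_cst 1)).
by under eq_fun do rewrite mul1r.
Qed.

Lemma L2D f g : L2 f -> L2 g -> L2 (fun x => f x + g x).
Proof.
move=> f2 g2.
have mfg : measurable_fun setT (fun x => f x + g x).
  by apply: measurable_funD; [case: f2|case: g2].
apply: integrable_L2 => //.
have h2 := integrableD measurableT (L2_sqr_integrable f2) (L2_sqr_integrable g2).
apply: (le_integrable measurableT _ _ (integrableZl measurableT 2 h2)).
  by apply/measurable_EFinP; exact: measurable_funX.
move=> x _; rewrite -EFinD -EFinM !abse_EFin lee_fin.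
rewrite ger0_norm ?sqr_ge0// ger0_norm ?mulr_ge0 ?addr_ge0 ?sqr_ge0//.
by have := sqr_ge0 (f x - g x); nra.
Qed.

Lemma L2Z c f : L2 f -> L2 (fun x => c * f x).
Proof.
move=> f2; have mf : measurable_fun setT (fun x => c * f x).
  by apply: measurable_funM; [exact: measurable_cst|case: f2].
apply: integrable_L2 => //.
under eq_fun do rewrite exprMn EFinM.
exact/integrableZl/L2_sqr_integrable.
Qed.

Lemma L2_sum (I : finType) (p : pred I) (F : I -> T -> R) :
  (forall i, p i -> L2 (F i)) -> L2 (fun x => \sum_(i | p i) F i x).
Proof.
move=> F2; elim: (index_enum I) => [|i r IH].
  by under eq_fun do rewrite big_nil; exact: L2_cst.
under eq_fun do rewrite big_cons.
by case pi: (p i) => //; apply: L2D => //; exact: F2.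
Qed.

Lemma innerC f g : inner f g = inner g f.
Proof. by apply: eq_Rintegral => x _; rewrite mulrC. Qed.

Lemma inner_EFin f g : L2 f -> L2 g ->
  (inner f g)%:E = (\int[P]_x (f x * g x)%:E)%E.
Proof.
move=> f2 g2; rewrite /inner /Rintegral fineK//.
by apply: integrable_fin_num => //; exact: L2_mul_integrable.
Qed.

Lemma inner0 f g : (forall x, f x = 0) -> inner f g = 0.
Proof.
by move=> f0; rewrite /inner /Rintegral integral0_eq// => x _; rewrite f0 mul0r.
Qed.

Lemma inner_suml (I : finType) (p : pred I) (F : I -> T -> R) g :
  (forall i, L2 (F i)) -> L2 g ->
  inner (fun x => \sum_(i | p i) F i x) g = \sum_(i | p i) inner (F i) g.
Proof.
move=> F2 g2; apply: EFin_inj; rewrite inner_EFin//; last first.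
  exact: L2_sum.
under eq_integral do rewrite mulr_suml -sumEFin.
rewrite integral_sum//; last by move=> i; exact: L2_mul_integrable.
by rewrite -sumEFin; apply: eq_bigr => i _; rewrite inner_EFin.
Qed.

Lemma innerZr c f g : L2 f -> L2 g -> inner f (fun x => c * g x) = c * inner f g.
Proof.
move=> f2 g2; rewrite /inner -RintegralZl//; last exact: L2_mul_integrable.
by apply: eq_Rintegral => x _; rewrite mulrCA.
Qed.

Lemma inner_ge0 f : 0 <= inner f f.
Proof. by apply: Rintegral_ge0 => x _; rewrite -expr2 sqr_ge0. Qed.

(** Expand (e f - c g)^2 >= 0. *)
Lemma inner_weighted f g (c e : R) : L2 f -> L2 g -> 0 < c -> 0 < e ->
  inner f g <= (e / c * inner f f + c / e * inner g g) / 2.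
Proof.
move=> f2 g2 c0 e0.
have fg_le x : f x * g x <= (e / c / 2 * (f x * f x) + c / e / 2 * (g x * g x)).
  have : 0 <= (e * f x - c * g x) ^+ 2 / (2 * c * e).
    by rewrite divr_ge0 ?sqr_ge0// !mulr_ge0// ltW.
  move=> h0; rewrite -subr_ge0; apply: (le_trans h0).
  rewrite le_eqVlt; apply/orP; left; apply/eqP; field.
  by rewrite !gt_eqF.
have int k h : L2 h -> P.-integrable setT (fun x => (k * (h x * h x))%:E).
  move=> h2; under eq_fun do rewrite EFinM.
  by apply: integrableZl => //; exact: L2_mul_integrable.
have -> : (e / c * inner f f + c / e * inner g g) / 2 =
   \int[P]_x (e / c / 2 * (f x * f x) + c / e / 2 * (g x * g x)).
  rewrite RintegralD//; [|exact: int|exact: int].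
  rewrite !RintegralZl//; try exact: L2_mul_integrable.
  by rewrite /inner; field; rewrite !gt_eqF.
apply: le_Rintegral => //; first exact: L2_mul_integrable.
exact: (integrableD _ (int (e / c / 2) _ f2) (int (c / e / 2) _ g2)).
Qed.

(** By [inner_weighted] with e = 1, the bound on (f, g) is c (g, g) / 2 for every
    c > 0; the lower bound is the upper one for - g. *)
Lemma inner_null f g : L2 f -> L2 g -> inner f f = 0 -> inner f g = 0.
Proof.
move=> f2 g2 f0.
have lb h : L2 h -> inner f h <= 0.
  move=> h2; have [h0|h0] := leP (inner h h) 0.
    have := inner_weighted f2 h2 ltr01 ltr01; rewrite f0 divr1 mulr0 add0r mul1r.
    lra.
  apply/ler_addgt0Pr => e e0; rewrite add0r.
  have := inner_weighted f2 h2 (divr_gt0 e0 h0) ltr01.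
  rewrite f0 mulr0 add0r divr1 divfK ?gt_eqF//; lra.
apply/eqP; rewrite eq_le lb//=.
by have := lb _ (L2Z (-1) g2); rewrite innerZr// mulN1r oppr_le0.
Qed.

End square_integrable_functions.

Lemma L2_transport d1 d2 (X : measurableType d1) (Y : measurableType d2)
    (R : realType) (P : probability X R) (Q : probability Y R) (phi : X -> Y) :
  measurable_fun setT phi ->
  (forall A, measurable A -> P (phi @^-1` A) = Q A) ->
  forall h, L2 Q h -> L2 P (h \o phi).
Proof.
move=> mphi lawE h h2; apply: integrable_L2.
  by apply: measurableT_comp => //; case: h2.
exact: (integrable_transport mphi lawE (L2_sqr_integrable h2)).
Qed.

Lemma inner_transport d1 d2 (X : measurableType d1) (Y : measurableType d2)
    (R : realType) (P : probability X R) (Q : probability Y R) (phi : X -> Y) :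
  measurable_fun setT phi ->
  (forall A, measurable A -> P (phi @^-1` A) = Q A) ->
  forall f g, measurable_fun setT f -> measurable_fun setT g ->
  inner P (f \o phi) (g \o phi) = inner Q f g.
Proof.
move=> mphi lawE f g mf mg; congr fine; apply/esym.
rewrite (integral_transport mphi lawE)//.
by apply/measurable_EFinP; exact: measurable_funM.
Qed.

(** A weighted Cauchy-Schwarz inequality for a family whose members are
    orthogonal unless related by r.  In the double sum of (F a, F b) over related
    pairs each term is bounded by [inner_weighted], and the two halves of the
    bound have equal sums as r is symmetric.  A null weight, whose inverse is 0,
    is only allowed for a null function. *)
Lemma inner_sum_le d (T : measurableType d) (R : realType) (P : probability T R)
    (I : finType) (F : I -> T -> R) (c : I -> R) (r : rel I) (S : R) :
  (forall a, L2 P (F a)) -> symmetric r ->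
  (forall a b, ~~ r a b -> inner P (F a) (F b) = 0) ->
  (forall a, 0 <= c a) -> (forall a, \sum_(b | r a b) c b <= S) ->
  (forall a, c a = 0 -> inner P (F a) (F a) = 0) ->
  inner P (fun x => \sum_a F a x) (fun x => \sum_a F a x) <=
    S * \sum_a (c a)^-1 * inner P (F a) (F a).
Proof.
move=> F2 rC ortho c0 cS Fnull.
pose N a := inner P (F a) (F a).
have sF2 : L2 P (fun x => \sum_a F a x) by exact: L2_sum.
have -> : inner P (fun x => \sum_a F a x) (fun x => \sum_a F a x) =
    \sum_a \sum_(b | r a b) inner P (F a) (F b).
  rewrite inner_suml//; apply: eq_bigr => a _.
  rewrite innerC inner_suml// [RHS]big_mkcond; apply: eq_bigr => b _.
  by case: ifPn => [_|/ortho <-]; exact: innerC.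
(* W a b is the share of (F a, F a) in the bound of (F a, F b) *)
pose W a b := c b * ((c a)^-1 * N a).
have half : \sum_a \sum_(b | r a b) W a b <= S * \sum_a (c a)^-1 * N a.
  rewrite mulr_sumr; apply: ler_sum => a _.
  rewrite -mulr_suml ler_wpM2r// mulr_ge0 ?invr_ge0//; exact: inner_ge0.
have swapW : \sum_a \sum_(b | r a b) W b a = \sum_a \sum_(b | r a b) W a b.
  rewrite (exchange_big_dep xpredT)//=; apply: eq_bigr => a _.
  by apply: eq_bigl => b; rewrite rC.
apply: le_trans (_ : \sum_a \sum_(b | r a b) (W a b + W b a) / 2 <= _).
  apply: ler_sum => a _; apply: ler_sum => b _.
  have W0 a' b' : 0 <= W a' b'.
    by rewrite !mulr_ge0// ?invr_ge0//; exact: inner_ge0.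
  have W2 : 0 <= (W a b + W b a) / 2 by rewrite divr_ge0// addr_ge0.
  have [ca0|ca0] := eqVneq (c a) 0.
    by rewrite inner_null//; exact: Fnull.
  have [cb0|cb0] := eqVneq (c b) 0.
    by rewrite innerC inner_null//; exact: Fnull.
  rewrite /W !mulrA; apply: inner_weighted => //; by rewrite lt_def ?ca0 ?cb0 c0.
rewrite (_ : \sum_a \sum_(b | r a b) (W a b + W b a) / 2 =
    \sum_a \sum_(b | r a b) W a b)//.
under eq_bigr do rewrite -mulr_suml big_split/=.
by rewrite -mulr_suml big_split/= swapW; lra.
Qed.

(** * Averages given some coordinates, and ANOVA terms *)

Section conditional_expectation.
Context (R : realType) (nu : set R -> \bar R).
Context (mu : forall n, probability (n.-tuple R) R).
Hypothesis nuT : nu setT = 1%E.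
Hypothesis mu_box : forall n (A : 'I_n -> set R),
  (forall i, measurable (A i)) -> mu n (box A) = (\prod_(i < n) nu (A i))%E.
Context (s : nat) (f : s.-tuple R -> R).
Hypothesis f2 : L2 (mu s) f.

(** The mean of f given the coordinates in u.  Integrating over all of y, and
    not just over its coordinates outside u, keeps the dimension independent
    of u. *)
Definition cond_mean (u : {set 'I_s}) (x : s.-tuple R) : R :=
  \int[mu s]_y f (mix u x y).

Lemma cond_mean_depends (u : {set 'I_s}) x y :
  (forall i, i \in u -> tnth x i = tnth y i) -> cond_mean u x = cond_mean u y.
Proof.
move=> xy; apply: eq_Rintegral => z _; congr f; apply: eq_from_tnth => i.
by rewrite !tnth_mktuple; case: ifP => // /xy.
Qed.

Section joint.
Context (m : nat) (tau : 'I_s -> 'I_m) (tauI : injective tau).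

Let prod : probability (m.-tuple R * s.-tuple R)%type R :=
  product_probability (mu m) (mu s).

Lemma L2_mix u : L2 prod (fun p => f (mix u (select tau p.1) p.2)).
Proof.
apply: (L2_transport (phi := fun p => mix u (select tau p.1) p.2)
  (measurable_mix _ _) _ f2).
exact: (mix_law nuT mu_box u tauI).
Qed.

Lemma fst_law A : measurable A -> prod (fst @^-1` A) = mu m A.
Proof.
move=> mA; transitivity (prod (A `*` setT)).
  by congr (prod _); apply/seteqP; split => -[x y] //= [].
by rewrite /= product_measure1E//= -[RHS]mule1 -(probability_setT (mu s)).
Qed.

Lemma L2_fst G : L2 (mu m) G -> L2 prod (fun p => G p.1).
Proof. exact: (L2_transport measurable_fst fst_law). Qed.

Lemma measurable_cond_mean_select u : measurable_fun setT (cond_mean u \o select tau).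
Proof.
have fi := L2_integrable (L2_mix u).
exact: (measurableT_comp (fine_measurable measurableT) (measurable_fubini_F fi)).
Qed.

(** Fubini.  The slice y |-> f (mix u z y) is integrable only for almost every z,
    which is enough under the integral over z. *)
Lemma inner_cond_mean u G : L2 (mu m) G ->
  inner (mu m) (cond_mean u \o select tau) G =
  \int[prod]_p (f (mix u (select tau p.1) p.2) * G p.1).
Proof.
move=> G2.
have fi := L2_integrable (L2_mix u).
have fGi := L2_mul_integrable (L2_mix u) (L2_fst G2).
congr fine; rewrite -(integral12_prod_meas1 fGi).
apply: ae_eq_integral => //.
- apply/measurable_EFinP; apply: measurable_funM.
    exact: measurable_cond_mean_select.
  by case: G2.
- exact: (measurable_fubini_F fGi).
have := ae_integrable1 fi.
apply: filterS => z zi _.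
rewrite /fubini_F /=; under [RHS]eq_integral do rewrite EFinM.
rewrite integralZr// EFinM; congr (_ * _)%E.
by rewrite /cond_mean /Rintegral fineK//; exact: integrable_fin_num.
Qed.

(** Exchanging the coordinate tau j of z with the coordinate j of y leaves G
    unchanged and turns the mix for u into the mix for u minus j. *)
Lemma inner_cond_mean_drop (u : {set 'I_s}) j G : L2 (mu m) G -> j \in u ->
  (forall z a, G (update z (tau j) a) = G z) ->
  inner (mu m) (cond_mean u \o select tau) G =
  inner (mu m) (cond_mean (u :\ j)%SET \o select tau) G.
Proof.
move=> G2 ju Gj; rewrite !inner_cond_mean//.
have fGi := L2_mul_integrable (L2_mix (u :\ j)%SET) (L2_fst G2).
have fGi' := L2_mul_integrable (L2_mix u) (L2_fst G2).
congr fine.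
rewrite [LHS](integral_transport (measurable_exchange (tau j) j)
  (exchange_law mu_box (tau j) j)); last exact: measurable_int fGi'.
apply: eq_integral => -[z y] _ /=; rewrite Gj; congr (f _ * _)%:E.
apply: eq_from_tnth => i; rewrite !tnth_mktuple finset.in_setD1.
have [->|ij] := eqVneq i j; first by rewrite ju eqxx.
by rewrite (inj_eq tauI) (negbTE ij).
Qed.

End joint.

Lemma measurable_cond_mean u : measurable_fun setT (cond_mean u).
Proof.
have := measurable_cond_mean_select (tau := id) (fun i j => id) u.
congr measurable_fun; apply/funext => x /=; congr cond_mean.
by apply: eq_from_tnth => i; rewrite tnth_mktuple.
Qed.

(** The ANOVA terms of f, given by the equations that determine them through
    Moebius inversion over the subsets of u. *)
Context (g : {set 'I_s} -> s.-tuple R -> R).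
Hypothesis gE : forall (u : {set 'I_s}) x,
  \sum_(v : {set 'I_s} | v \subset u) g v x = cond_mean u x.

Lemma componentE (u : {set 'I_s}) x :
  g u x = cond_mean u x - \sum_(v : {set 'I_s} | v \proper u) g v x.
Proof.
rewrite -gE (bigD1 u)//=; apply/esym/eqP; rewrite subr_eq; apply/eqP.
by congr (_ + _); apply: eq_bigl => v; rewrite finset.properEneq andbC.
Qed.

Lemma measurable_component u : measurable_fun setT (g u).
Proof.
have [n] := ubnP #|u|; elim: n u => // n IH u un.
rewrite (_ : g u = fun x => cond_mean u x -
  \sum_(v : {set 'I_s} | v \proper u) g v x); last first.
  by apply/funext => x; exact: componentE.
apply: measurable_funB; first exact: measurable_cond_mean.
rewrite (_ : (fun x => _) = (fun x => \sum_(v : {set 'I_s})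
   if v \proper u then g v x else 0)); last first.
  by apply/funext => x; rewrite big_mkcond.
apply: measurable_sum => v; case vu: (v \proper u) => //.
by apply: IH; rewrite -ltnS (leq_trans _ un)// ltnS proper_card.
Qed.

Lemma component_depends (u : {set 'I_s}) x y :
  (forall i, i \in u -> tnth x i = tnth y i) -> g u x = g u y.
Proof.
have [n] := ubnP #|u|; elim: n u => // n IH u un xy.
rewrite !componentE (cond_mean_depends xy); congr (_ - _).
apply: eq_bigr => v vu; apply: IH => [|i iv].
  by rewrite -ltnS (leq_trans _ un)// ltnS proper_card.
by apply: xy; exact: (fintype.subsetP (proper_sub vu) _ iv).
Qed.

Hypothesis g2 : forall u, L2 (mu s) (g u).

Section orthogonality.
Context (m : nat) (tau : 'I_s -> 'I_m) (tauI : injective tau).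

Lemma L2_component_select u : L2 (mu m) (g u \o select tau).
Proof.
exact: (L2_transport (measurable_select _) (select_law nuT mu_box tauI) (g2 u)).
Qed.

(** By [inner_cond_mean_drop] the sums of (g v, G) over the subsets of u and over
    the subsets of u minus j agree.  Hence the (g v, G) with v containing j sum
    to 0, and by induction all of them but the one for u itself vanish. *)
Lemma inner_component0 (u : {set 'I_s}) j G : L2 (mu m) G -> j \in u ->
  (forall z a, G (update z (tau j) a) = G z) ->
  inner (mu m) (g u \o select tau) G = 0.
Proof.
move=> G2 ju Gj.
have [n] := ubnP #|u|; elim: n u ju => // n IH u ju un.
have sumE v : inner (mu m) (cond_mean v \o select tau) G =
    \sum_(w : {set 'I_s} | w \subset v) inner (mu m) (g w \o select tau) G.
  rewrite -inner_suml//; last by move=> w; exact: L2_component_select.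
  by apply: eq_Rintegral => z _; rewrite /= gE.
have := inner_cond_mean_drop tauI G2 ju Gj; rewrite !sumE (bigD1 u)//=.
rewrite (bigID (fun w : {set 'I_s} => j \in w))/= big1 ?add0r; last first.
  move=> w /andP[/andP[wu wNu] jw]; apply: IH => //.
  rewrite -ltnS (leq_trans _ un)// ltnS proper_card//.
  by rewrite finset.properEneq wNu wu.
rewrite [X in _ + X](_ : _ =
  \sum_(w : {set 'I_s} | w \subset u :\ j) inner (mu m) (g w \o select tau) G);
  last first.
  apply: eq_bigl => w; rewrite finset.subsetD1 -andbA; congr (_ && _).
  by have [->|_] := eqVneq w u; rewrite ?ju//= .
by move=> /(canRL (addrK _)); rewrite subrr.
Qed.

(** A sample index k in the image of u but not of v is one that the second factor
    ignores, so [inner_component0] applies. *)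
Lemma inner_components0 (tau' : 'I_s -> 'I_m) (u v : {set 'I_s}) : injective tau' ->
  ~~ ((tau @: u)%SET \subset (tau' @: v)%SET) ->
  inner (mu m) (g u \o select tau) (g v \o select tau') = 0.
Proof.
move=> tau'I /fintype.subsetPn[k /imsetP[j ju ->] kv].
apply: (inner_component0 _ ju).
  exact: (L2_transport (measurable_select _) (select_law nuT mu_box tau'I) (g2 v)).
move=> z a /=; apply: component_depends => i iv; rewrite !tnth_mktuple.
by case: eqP => // ij; move/negP: kv; case; rewrite -ij; exact: imset_f.
Qed.

End orthogonality.

End conditional_expectation.

(** * Probabilities with a density *)

Section density.
Context d (T : measurableType d) (R : realType).
Context (m : {sigma_finite_measure set T -> \bar R}) (h : T -> R).
Hypothesis mh : measurable_fun setT h.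
Hypothesis h0 : forall x, 0 <= h x.

Let mEh : measurable_fun setT (fun x => (h x)%:E).
Proof. exact/measurable_EFinP. Qed.

Lemma density_measure : (\int[m]_x (h x)%:E = 1)%E ->
  exists P : probability T R,
    forall A, P A = (\int[m]_(x in A) (h x)%:E)%E.
Proof.
move=> h1; pose M A := (\int[m]_(x in A) (h x)%:E)%E.
have M0 : M set0 = 0%E by rewrite /M integral_set0.
have M_ge0 A : (0 <= M A)%E by apply: integral_ge0 => x _; rewrite lee_fin.
have Msigma : semi_sigma_additive M.
  move=> F mF tF mUF; rewrite /M ge0_integral_bigcup//; last 2 first.
  - exact: measurable_funTS.
  - by move=> x _; rewrite lee_fin.
  by apply: is_cvg_nneseries => n _ _; exact: M_ge0.
pose isM := isMeasure.Build _ _ _ M M0 M_ge0 Msigma.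
pose MM : {measure set T -> \bar R} := HB.pack M isM.
pose isP := Measure_isProbability.Build _ _ _ MM h1.
pose P : probability T R := HB.pack (MM : set T -> \bar R) MM isP.
by exists P.
Qed.

Context (P : probability T R).
Hypothesis PE : forall A, P A = (\int[m]_(x in A) (h x)%:E)%E.

(** The Radon-Nikodym derivative of P is almost everywhere equal to h. *)
Lemma ge0_integral_density (k : T -> \bar R) :
  measurable_fun setT k -> (forall x, 0 <= k x)%E ->
  (\int[P]_x k x = \int[m]_x (k x * (h x)%:E))%E.
Proof.
move=> mk k0.
have Pm : P `<< m.
  apply/null_content_dominatesP => A mA mA0.
  rewrite PE; apply: null_set_integral => //.
  exact: measurable_funTS.
rewrite -(Radon_Nikodym_SigmaFinite.change_of_variables Pm)//.
have rn := Radon_Nikodym_SigmaFinite.f_integrable Pm.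
apply: ae_eq_integral => //.
- by apply: emeasurable_funM => //; exact: measurable_int rn.
- exact: emeasurable_funM.
apply: ae_eqe_mul2l.
apply: integral_ae_eq => // E _ mE.
by rewrite -PE -Radon_Nikodym_SigmaFinite.f_integral.
Qed.

(** As h >= 0, the positive and negative parts of k h are those of k times h. *)
Lemma integral_density (k : T -> R) : measurable_fun setT k ->
  (\int[P]_x (k x)%:E = \int[m]_x (k x * h x)%:E)%E.
Proof.
move=> mk; have mEk : measurable_fun setT (fun x => (k x)%:E).
  exact/measurable_EFinP.
rewrite integralE [RHS]integralE.
rewrite !ge0_integral_density//; last 2 first.
- exact: measurable_funeneg.
- exact: measurable_funepos.
congr (_ - _)%E; apply: eq_integral => x _.
  by rewrite !funeposE -EFin_max -EFinM -EFin_max maxr_pMl// mul0r.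
by rewrite !funenegE -!EFinN -EFin_max -EFinM -EFin_max maxr_pMl// mul0r mulNr.
Qed.

End density.

(** Tonelli, one coordinate at a time. *)
Lemma integral_tuple_prod (R : realType) n (w : 'I_n -> R -> R) :
  (forall i, measurable_fun setT (w i)) -> (forall i x, 0 <= w i x) ->
  (\int[@lebesgue_tuple R n]_x (\prod_(i < n) w i (tnth x i))%:E =
   \prod_(i < n) \int[lebesgue_measure]_x (w i x)%:E)%E.
Proof.
elim: n w => [|n IH] w mw w0.
  rewrite big_ord0; under eq_integral do rewrite big_ord0.
  rewrite integral_cst//= mul1e.
  by rewrite diracE mem_set.
have mprod p (v : 'I_p -> R -> R) : (forall i, measurable_fun setT (v i)) ->
    measurable_fun setT
      (fun x : p.-tuple R => (\prod_(i < p) v i (tnth x i))%:E).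
  move=> mv; apply/measurable_EFinP; apply: measurable_prod => i _.
  exact: (measurableT_comp (mv i) (measurable_tnth i)).
rewrite big_ord_recl -IH//.
rewrite [LHS](ge0_integral_transport
    (P := (lebesgue_measure \x @lebesgue_tuple R n)%E)
    (@measurable_tuple_cons R n))//; last 2 first.
- exact: mprod.
- by move=> x; rewrite lee_fin prodr_ge0.
rewrite fubini_tonelli1; last 2 first.
- apply: (measurableT_comp (mprod _ _ mw)); exact: measurable_tuple_cons.
- by move=> x; rewrite lee_fin prodr_ge0.
rewrite -ge0_integralZr//; last 3 first.
- by have /measurable_EFinP := mw ord0.
- by move=> x _; rewrite lee_fin.
- by apply: integral_ge0 => x _; rewrite lee_fin prodr_ge0.
apply: eq_integral => a _; rewrite /fubini_F.
rewrite -ge0_integralZl//; last 3 first.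
- exact: (mprod n (fun i => w (lift ord0 i)) (fun i => mw (lift ord0 i))).
- by move=> x _; rewrite lee_fin prodr_ge0.
- by rewrite lee_fin.
apply: eq_integral => y _; rewrite big_ord_recl EFinM; congr (_ * _)%E.
by congr (_%:E); apply: eq_bigr => i _; rewrite tnthS.
Qed.

(** * The powers of rho, and ANOVA terms on Omega^s *)

Section density_power.
Context (R : realType) (Omega : set R) (rho : R -> R).
Hypothesis rho_dens : is_density Omega rho.

Let w : R -> R := rho \_ Omega.

(** The law of density rho: extending rho by 0 outside Omega replaces integrals
    over Omega by integrals over R. *)
Definition rho_law (A : set R) : \bar R :=
  (\int[lebesgue_measure]_(x in A) ((rho \_ Omega) x)%:E)%E.

Let mw : measurable_fun setT w.
Proof. by case: rho_dens => mO mr _ _; exact: (measurable_restrictT _ mO).1. Qed.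

Let w0 x : 0 <= w x.
Proof.
case: rho_dens => _ _ r0 _; rewrite /w patchE.
by case: ifPn => // /[!inE]; exact: r0.
Qed.

Definition rho_tuple n (x : n.-tuple R) : R :=
  \prod_(j < n) (rho \_ Omega) (tnth x j).

Lemma rho_lawE A : rho_law A =
  (\int[lebesgue_measure]_(x in Omega `&` A) (rho x)%:E)%E.
Proof.
rewrite /rho_law setIC integral_mkcondr; apply: eq_integral => x _.
by rewrite restrict_EFin.
Qed.

Lemma rho_lawT : rho_law setT = 1%E.
Proof. by rewrite rho_lawE setIT; case: rho_dens. Qed.

Lemma measurable_rho_tuple n : measurable_fun setT (@rho_tuple n).
Proof.
apply: measurable_prod => i _.
exact: (measurableT_comp mw (measurable_tnth i)).
Qed.

Lemma rho_tuple_ge0 n (x : n.-tuple R) : 0 <= rho_tuple x.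
Proof. by apply: prodr_ge0 => i _; exact: w0. Qed.

Lemma rho_tuple_power : exists mu : forall n, probability (n.-tuple R) R,
  forall n A,
    mu n A = (\int[@lebesgue_tuple R n]_(x in A) (rho_tuple x)%:E)%E.
Proof.
have int1 n : (\int[@lebesgue_tuple R n]_x (rho_tuple x)%:E = 1)%E.
  rewrite (integral_tuple_prod (w := fun=> w))//.
  by rewrite big1// => i _; have := rho_lawT.
have ex n := cid (density_measure (@measurable_rho_tuple n)
  (@rho_tuple_ge0 n) (int1 n)).
by exists (fun n => projT1 (ex n)) => n A; exact: projT2 (ex n) A.
Qed.

Context (mu : forall n, probability (n.-tuple R) R).
Hypothesis muE : forall n A,
  mu n A = (\int[@lebesgue_tuple R n]_(x in A) (rho_tuple x)%:E)%E.

Lemma rho_tuple_box n (A : 'I_n -> set R) : (forall i, measurable (A i)) ->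
  mu n (box A) = (\prod_(i < n) rho_law (A i))%E.
Proof.
move=> mA; rewrite muE integral_mkcond.
rewrite (eq_integral (fun x => (\prod_(i < n) (w \_ (A i)) (tnth x i))%:E)).
  rewrite (integral_tuple_prod (w := fun i => w \_ (A i))).
  - by apply: eq_bigr => i _; rewrite /rho_law [RHS]integral_mkcond restrict_EFin.
  - by move=> i; apply: (measurable_restrictT _ (mA i)).1; exact: measurable_funTS.
  - by move=> i x; rewrite patchE; case: ifP.
move=> x _; rewrite patchE; case: ifPn => [/[!inE] xA|xA].
  congr (_%:E); apply: eq_bigr => i _.
  by rewrite [in RHS]patchE mem_set//; exact: xA.
apply/eqP; rewrite eq_sym eqe; apply/prodf_eq0.
move: xA; rewrite notin_setE => /existsNP[i xAi].
by exists i => //; rewrite patchE memNset.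
Qed.

Context (a0 : R) (Omega_a0 : Omega a0).

(** Any measurable map R -> Omega that is the identity on Omega would do; a0 is
    an arbitrary point of Omega. *)
Definition retract1 (a : R) : R := if a \in Omega then a else a0.

Definition retract n (x : n.-tuple R) : n.-tuple R :=
  [tuple retract1 (tnth x i) | i < n].

Lemma retract1P a : Omega (retract1 a).
Proof. by rewrite /retract1; case: ifPn => // /[!inE]. Qed.

Lemma retractP n (x : n.-tuple R) : Omega_pow Omega (retract x).
Proof. by move=> i; rewrite tnth_mktuple; exact: retract1P. Qed.

Lemma retract_id n (x : n.-tuple R) : Omega_pow Omega x -> retract x = x.
Proof.
by move=> xO; apply: eq_from_tnth => i; rewrite tnth_mktuple /retract1 mem_set.
Qed.

Lemma retract_mix n u (x y : n.-tuple R) :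
  retract (mix u x y) = mix u (retract x) (retract y).
Proof.
by apply: eq_from_tnth => i; rewrite !tnth_mktuple; case: ifP.
Qed.

Lemma measurable_retract1 : measurable_fun setT retract1.
Proof.
case: rho_dens => mO _ _ _.
apply: measurable_fun_ifT => //.
apply: (measurable_fun_bool true); rewrite setTI.
rewrite [X in measurable X](_ : _ = Omega)//.
by apply/seteqP; split => x /=; [exact: set_mem|exact: mem_set].
Qed.

Lemma measurable_retract n : measurable_fun setT (@retract n).
Proof.
apply: measurable_tupleP => i.
under eq_fun do rewrite tnth_mktuple.
exact: (measurableT_comp measurable_retract1 (measurable_tnth i)).
Qed.

Lemma measurable_Omega_pow n : measurable (@Omega_pow R Omega n).
Proof. by case: rho_dens => mO _ _ _; exact: (@measurable_box _ _ (fun=> Omega)). Qed.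

Lemma measurable_comp_retract n (f : n.-tuple R -> R) :
  measurable_fun (@Omega_pow R Omega n) f -> measurable_fun setT (f \o @retract n).
Proof.
move=> mf; apply: (measurable_comp (@measurable_Omega_pow n) _ mf).
  by move=> _ [x _ <-]; exact: retractP.
exact: measurable_retract.
Qed.

(** The law mu n is carried by Omega^n, where the retraction is the identity. *)
Lemma I_rhoE n (f : n.-tuple R -> R) : measurable_fun setT (f \o @retract n) ->
  (I_rho Omega rho f = \int[mu n]_x (f (retract x))%:E)%E.
Proof.
move=> mf.
rewrite (integral_density (@measurable_rho_tuple n) (@rho_tuple_ge0 n)
  (@muE n))// /I_rho integral_mkcond.
apply: eq_integral => x _; rewrite patchE; case: ifPn => [/[!inE] xO|xO].
  rewrite retract_id//; congr (_ * _)%:E; apply: eq_bigr => i _.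
  by rewrite patchE mem_set//; exact: xO.
apply/eqP; rewrite eq_sym eqe mulf_eq0; apply/orP; right.
apply/prodf_eq0; move: xO; rewrite notin_setE => /existsNP[i xOi].
by exists i => //; rewrite patchE memNset.
Qed.

Context (s : nat) (f : s.-tuple R -> R).
Hypothesis fsq : square_integrable Omega rho f.

Let F : s.-tuple R -> R := f \o @retract s.

Lemma L2_comp_retract : L2 (mu s) F.
Proof.
case: fsq => mf foo; have mF := measurable_comp_retract mf.
split => //; rewrite -(I_rhoE (f := fun x => f x ^+ 2))//.
exact: measurable_funX.
Qed.

Lemma index_setC_lt (u : {set 'I_s}) i : i \notin u ->
  (index i (enum (~: u)) < #|~: u|)%N.
Proof. by move=> iu; rewrite cardE index_mem mem_enum inE. Qed.

Lemma glue_select (u : {set 'I_s}) (x y : s.-tuple R) :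
  @Defs.glue R s u x (select (fun k : 'I_#|~: u| => enum_val k) y) = mix u x y.
Proof.
apply: eq_from_tnth => i; rewrite !tnth_mktuple; case: ifPn => // iu.
have p := index_setC_lt iu.
rewrite (_ : index i _ = Ordinal p)// -tnth_nth tnth_mktuple; congr (tnth y _).
by rewrite (enum_val_nth i)/= nth_index// mem_enum inE.
Qed.

Lemma measurable_glue (u : {set 'I_s}) x :
  measurable_fun setT (fun y => @Defs.glue R s u x y).
Proof.
apply: measurable_tupleP => i.
under eq_fun do rewrite tnth_mktuple.
have [iu|iu] := boolP (i \in u); first exact: measurable_cst.
have p := index_setC_lt iu.
under eq_fun do rewrite (_ : index i _ = Ordinal p)// -tnth_nth.
exact: measurable_tnth.
Qed.

(** The integral over the coordinates outside u is the integral over a full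
    point y, whose coordinates outside u are selected by [glue_select]. *)
Lemma marginalE u x : Omega_pow Omega x ->
  marginal Omega rho f u x = cond_mean mu F u x.
Proof.
move=> xO; have [mF _] := L2_comp_retract.
have fg y : f (@Defs.glue R s u x (retract y)) = F (@Defs.glue R s u x y).
  rewrite /F /=; congr f; apply: eq_from_tnth => i; rewrite !tnth_mktuple.
  case: ifPn => iu; first by rewrite /retract1 mem_set//; exact: xO.
  have p := index_setC_lt iu.
  by rewrite (_ : index i _ = Ordinal p)// -!tnth_nth tnth_mktuple.
have mFg : measurable_fun setT (fun y => F (@Defs.glue R s u x y)).
  exact: (measurableT_comp mF (measurable_glue x)).
rewrite /marginal I_rhoE; last first.
  by rewrite (_ : _ \o _ = fun y => F (@Defs.glue R s u x y))//; exact/funext.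
congr fine.
rewrite (eq_integral (fun y => (F (@Defs.glue R s u x y))%:E)); last first.
  by move=> y _; rewrite -fg.
rewrite (integral_transport (measurable_select (fun k : 'I_#|~: u| => enum_val k))
  (select_law rho_lawT rho_tuple_box enum_val_inj)); last exact/measurable_EFinP.
by apply: eq_integral => y _; rewrite glue_select.
Qed.

(** For nonempty u this is the recursive definition of the ANOVA term of u; for u
    empty both sides are the integral of f. *)
Lemma sum_anova (u : {set 'I_s}) x :
  \sum_(v : {set 'I_s} | v \subset u) anova Omega rho f v (retract x) =
  cond_mean mu F u x.
Proof.
have [mF _] := L2_comp_retract.
have -> : cond_mean mu F u x = cond_mean mu F u (retract x).
  apply: eq_Rintegral => y _; rewrite /F /= !retract_mix; congr (f (mix _ _ _)).
  by rewrite [RHS]retract_id//; exact: retractP.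
rewrite -marginalE; last exact: retractP.
have [->|u0] := eqVneq u finset.set0.
  rewrite (big_pred1 finset.set0) => [|v]; last by rewrite finset.subset0.
  rewrite anova_set0 marginalE; last exact: retractP.
  rewrite I_rhoE//; congr fine; apply: eq_integral => y _; congr (F _)%:E.
  by apply: eq_from_tnth => i; rewrite tnth_mktuple finset.in_set0.
rewrite (bigD1 u)//= anovaE// [X in _ + X](eq_bigl (fun v : {set 'I_s} => v \proper u)).
  by rewrite subrK.
by move=> v; rewrite finset.properEneq andbC.
Qed.

End density_power.

(** * Aligned terms *)

(** The arrow j |-> i + s - 1 - j from the coordinates of the i-th point to the
    sample indices. *)
Definition toeplitz_index s n (i : 'I_n) (j : 'I_s) : 'I_(n + s - 1) :=
  Ordinal (toeplitz_subproof i j).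

Lemma toeplitz_index_inj s n (i : 'I_n) : injective (@toeplitz_index s n i).
Proof.
move=> j k [] /= jk; apply/val_inj => /=.
by have := ltn_ord j; have := ltn_ord k; lia.
Qed.

Definition is_min s (u : {set 'I_s}) (l : 'I_s) : bool :=
  (l \in u) && [forall j in u, (l <= j)%N].

Lemma ex_min s (u : {set 'I_s}) : u != finset.set0 -> exists l, is_min u l.
Proof.
move=> /set0Pn[j ju].
case: (arg_minnP (fun i : 'I_s => val i) ju) => l lu lmin.
exists l; rewrite /is_min (lu : l \in u)/=; apply/forall_inP => k ku; exact: lmin.
Qed.

(** The terms f_u (x_i) and f_v (x_i') involve the same sample values.  The terms
    of the empty set stay outside, as f minus its integral has none. *)
Definition aligned s n : rel ('I_n * {set 'I_s}) := fun a b =>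
  (a.2 != finset.set0) &&
  ((toeplitz_index a.1 @: a.2)%SET == (toeplitz_index b.1 @: b.2)%SET).

Lemma aligned_sym s n : symmetric (@aligned s n).
Proof.
move=> a b; rewrite /aligned [X in _ && X = _]eq_sym; apply: andb_id2r => /eqP ab.
by rewrite -(imset_eq0 (toeplitz_index a.1)) -ab imset_eq0.
Qed.

(** The greatest sample index of an aligned class is i + s - 1 - min u, so i is
    determined by min u, and then so is u. *)
Lemma aligned_min_inj s n (a b : 'I_n * {set 'I_s}) l :
  aligned a b -> is_min a.2 l -> is_min b.2 l -> a = b.
Proof.
case: a b => [i u] [i' v] /andP[/= _ /eqP uv] /andP[lu /forall_inP lminu].
move=> /andP[lv /forall_inP lminv].
have ii' : i = i'.
  apply/val_inj/eqP; rewrite eqn_leq; apply/andP; split.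
    have := imset_f (toeplitz_index i) lu; rewrite uv => /imsetP[k kv [] E].
    by have := lminv _ kv; have := ltn_ord k; have := ltn_ord l; move: E => /=; lia.
  have := imset_f (toeplitz_index i') lv; rewrite -uv => /imsetP[k kv [] E].
  by have := lminu _ kv; have := ltn_ord k; have := ltn_ord l; move: E => /=; lia.
move: uv; rewrite -ii' => /imset_inj uv; congr pair; apply: uv.
exact: toeplitz_index_inj.
Qed.

(** Sort the class of a by the least elements of the sets: each l < s is the
    least element of at most one member, whose weight is at most
    max_weight gamma l. *)
Lemma sum_aligned_le (R : realType) (gamma : set nat -> R) s n
    (a : 'I_n * {set 'I_s}) :
  (forall u, 0 <= gamma u) ->
  \sum_(b | aligned a b) gamma (indices b.2) <= sum_max_weight gamma s.
Proof.
move=> gamma0; have [a0|/set0Pn[j0 _]] := eqVneq a.2 finset.set0.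
  rewrite big_pred0 => [|b]; last by rewrite /aligned a0 eqxx.
  by apply: sumr_ge0 => l _; exact: bigmax_ge_id.
(* the least element of b.2; j0 is a default value for empty sets *)
pose p (b : 'I_n * {set 'I_s}) := odflt j0 [pick l | is_min b.2 l].
have pP b : aligned a b -> is_min b.2 (p b).
  rewrite aligned_sym => /andP[/ex_min[l lmin] _]; rewrite /p.
  by case: pickP => [//|/(_ l)]; rewrite lmin.
rewrite (partition_big p xpredT)//=; apply: ler_sum => l _.
have [[b /andP[ab /eqP pb]]|nob] :=
    pselect (exists b, aligned a b && (p b == l)); last first.
  rewrite big_pred0 => [|b]; first exact: bigmax_ge_id.
  by apply/negP => h; apply: nob; exists b.
rewrite (big_pred1 b) => [|c].
  have := pP b ab; rewrite pb => bl; rewrite /max_weight.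
  exact: (le_bigmax_cond _ (fun u : {set 'I_s} => gamma (indices u)) bl).
apply/idP/eqP => [/andP[ac /eqP pc]|->]; last by rewrite ab pb eqxx.
apply: (@aligned_min_inj _ _ _ _ l).
- move: ab ac; rewrite ![aligned a _]aligned_sym.
  move=> /andP[b0 /eqP ba] /andP[c0 /eqP ca].
  by rewrite /aligned c0 ca ba eqxx.
- by rewrite -pc; exact: pP.
- by rewrite -pb; exact: pP.
Qed.

(** * The mean square error *)

Section sample_law.
Context (R : realType) d (T : measurableType d) (P : probability T R).
Context (Omega : set R) (rho : R -> R).
Hypothesis rho_dens : is_density Omega rho.
Context (mu : forall n, probability (n.-tuple R) R).
Hypothesis muE : forall n A,
  mu n A = (\int[@lebesgue_tuple R n]_(x in A) (rho_tuple Omega rho x)%:E)%E.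
Context n (X : 'I_n -> {RV P >-> R}).
Hypothesis iidX : iid_sample Omega rho X.

Definition sample (w : T) : n.-tuple R := [tuple X k w | k < n].

Lemma measurable_sample : measurable_fun setT sample.
Proof.
apply: measurable_tupleP => i.
under eq_fun do rewrite tnth_mktuple.
exact: measurable_funPT.
Qed.

Lemma sample_law A : measurable A -> P (sample @^-1` A) = mu n A.
Proof.
apply: (tuple_law (rho_tuple_box rho_dens muE)); first exact: measurable_sample.
case: iidX => _ distX indX B mB.
have := indX finset.setT B mB.
rewrite (eq_bigl xpredT) => [|i]; last by rewrite finset.in_setT.
rewrite (_ : \bigcap_(i in _) _ = sample @^-1` box B); last first.
  apply/seteqP; split => w /= wB i.
    by rewrite tnth_mktuple; apply: wB; rewrite /= finset.in_setT.
  by have := wB i; rewrite tnth_mktuple.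
move=> ->; apply: eq_bigr => i _.
by rewrite rho_lawE -(distX i).
Qed.

End sample_law.

Section mean_square_error.
Context (R : realType) (Omega : set R) (rho : R -> R).
Hypothesis rho_dens : is_density Omega rho.
Context (mu : forall n, probability (n.-tuple R) R).
Hypothesis muE : forall n A,
  mu n A = (\int[@lebesgue_tuple R n]_(x in A) (rho_tuple Omega rho x)%:E)%E.
Context (a0 : R) (Omega_a0 : Omega a0).
Context (gamma : set nat -> R) (gamma0 : forall u, 0 <= gamma u).
Context (s : nat) (f : s.-tuple R -> R).
Hypothesis fW : weighted_space Omega rho gamma f.

Let fsq : square_integrable Omega rho f. Proof. by case: fW. Qed.

Let g (u : {set 'I_s}) : s.-tuple R -> R :=
  anova Omega rho f u \o @retract R Omega a0 s.

Let gE (u : {set 'I_s}) x :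
  \sum_(v : {set 'I_s} | v \subset u) g v x =
  cond_mean mu (f \o @retract R Omega a0 s) u x.
Proof. exact: (sum_anova rho_dens muE Omega_a0 fsq). Qed.

Let F2 : L2 (mu s) (f \o @retract R Omega a0 s).
Proof. exact: (L2_comp_retract rho_dens muE Omega_a0 fsq). Qed.

Let nuT := rho_lawT rho_dens.
Let mu_box := rho_tuple_box rho_dens muE.

Let mg u : measurable_fun setT (g u).
Proof. exact: (measurable_component nuT mu_box F2 gE). Qed.

Lemma I_rho_anova_sqr u :
  (I_rho Omega rho (fun x => (anova Omega rho f u x ^+ 2)%R) =
   \int[mu s]_x ((g u x) ^+ 2)%:E)%E.
Proof.
rewrite (I_rhoE rho_dens muE (a0 := a0))//.
exact: (measurable_funX 2 (mg u)).
Qed.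

(** As gamma_u = 0, f_u vanishes where rho_s > 0, outside a null
    set; where rho_s = 0, the density of mu s vanishes. *)
Lemma anova_null u : gamma (indices u) = 0 ->
  (\int[mu s]_x ((g u x) ^+ 2)%:E = 0)%E.
Proof.
case: fW => _ _ /[apply] ae0.
rewrite (integral_density (measurable_rho_tuple rho_dens (n := s))
  (@rho_tuple_ge0 _ _ _ rho_dens s) (@muE s)); last exact: measurable_funX.
rewrite (ae_eq_integral (cst 0%E)) ?integral0//.
  apply/measurable_EFinP; apply: measurable_funM; first exact: measurable_funX.
  exact: measurable_rho_tuple.
move: ae0; apply: filterS => x x0 _ /=.
have [->|r0] := eqVneq (rho_tuple Omega rho x) 0; first by rewrite mulr0.
have xO : Omega_pow Omega x.
  move=> i; apply: contrapT => xi; move/negP: r0; apply.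
  by apply/prodf_eq0; exists i => //; rewrite patchE memNset.
have rE : rho_pow rho x = rho_tuple Omega rho x.
  by apply: eq_bigr => i _; rewrite patchE mem_set//; exact: xO.
rewrite /g /= retract_id// x0// ?expr0n ?mul0r// rE lt_def r0.
exact: rho_tuple_ge0.
Qed.

Hypothesis f1 : (anova_norm Omega rho gamma f <= 1)%E.

Lemma anova_norm_sum : (\sum_(u : {set 'I_s})
  ((gamma (indices u))^-1)%:E * \int[mu s]_x ((g u x) ^+ 2)%:E <= 1)%E.
Proof.
set S := (X in (X <= 1)%E).
have S0 : (0 <= S)%E.
  apply: sume_ge0 => u _; apply: mule_ge0; first by rewrite lee_fin invr_ge0.
  by apply: integral_ge0 => x _; rewrite lee_fin sqr_ge0.
have S1 : (S `^ 2^-1 <= 1)%E.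
  apply: le_trans f1; rewrite /anova_norm le_eqVlt; apply/orP; left; apply/eqP.
  by congr (_ `^ _)%E; apply: eq_bigr => u _; rewrite I_rho_anova_sqr.
have -> : S = ((S `^ 2^-1) `^ 2)%E.
  by rewrite -poweRrM mulVf ?poweRe1// pnatr_eq0.
rewrite -[leRHS](@poweR1r R 2); apply: gt0_ler_poweR => //.
  by rewrite in_itv/= poweR_ge0 leey.
by rewrite in_itv/= lee_fin ler01 leey.
Qed.

(** Square integrability of f_u comes from the norm when gamma_u > 0, and from
    [anova_null] when gamma_u = 0. *)
Lemma L2_anova u : L2 (mu s) (g u).
Proof.
split; first exact: mg.
have [/anova_null->|gu] := eqVneq (gamma (indices u)) 0; first exact: ltry.
have gu0 : 0 < (gamma (indices u))^-1 by rewrite invr_gt0 lt_def gu gamma0.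
have := anova_norm_sum; rewrite (bigD1 u)//=.
set A := (\int[_]_x _)%E; set B := (\sum_(_ | _) _)%E => AB.
have A0 : (0 <= A)%E by apply: integral_ge0 => x _; rewrite lee_fin sqr_ge0.
have B0 : (0 <= B)%E.
  apply: sume_ge0 => v _; apply: mule_ge0; first by rewrite lee_fin invr_ge0.
  by apply: integral_ge0 => x _; rewrite lee_fin sqr_ge0.
rewrite ltNge leye_eq; apply/negP => /eqP Aoo.
by move: AB; rewrite Aoo gt0_muley// addye// ?gt_eqF ?(lt_le_trans _ B0)//.
Qed.

Let N u : R := inner (mu s) (g u) (g u).

Lemma anova_norm_inner : \sum_(u : {set 'I_s}) (gamma (indices u))^-1 * N u <= 1.
Proof.
rewrite -lee_fin -sumEFin; apply: le_trans anova_norm_sum.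
apply: lee_sum => u _; rewrite EFinM inner_EFin; [|exact: L2_anova..].
by under eq_integral do rewrite -expr2.
Qed.

Context (n : nat) (n0 : (0 < n)%N).

(** The term (i, u) of the error, as a function of the sample; 0 for u empty, as
    the empty ANOVA term is the integral that the estimator approximates. *)
Let G (a : 'I_n * {set 'I_s}) : (n + s - 1).-tuple R -> R :=
  if a.2 == finset.set0 then fun=> 0 else g a.2 \o select (toeplitz_index a.1).

Let G2 a : L2 (mu (n + s - 1)) (G a).
Proof.
rewrite /G; case: ifP => _; first exact: L2_cst.
exact: (L2_component_select nuT mu_box L2_anova (@toeplitz_index_inj s n a.1)).
Qed.

Let innerG a : a.2 != finset.set0 -> inner (mu (n + s - 1)) (G a) (G a) = N a.2.
Proof.
move=> a20; rewrite /G (negbTE a20).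
exact: (inner_transport (measurable_select _)
  (select_law nuT mu_box (@toeplitz_index_inj s n a.1)) (mg _) (mg _)).
Qed.

(** [inner_sum_le] for the aligned relation and the weights gamma; each of the n
    points contributes at most the squared norm of f, which is at most 1. *)
Lemma toeplitz_variance_le :
  inner (mu (n + s - 1)) (fun z => \sum_a G a z) (fun z => \sum_a G a z) <=
  sum_max_weight gamma s * n%:R.
Proof.
have S0 : 0 <= sum_max_weight gamma s.
  by apply: sumr_ge0 => l _; exact: bigmax_ge_id.
apply: (le_trans (inner_sum_le (c := fun a => gamma (indices a.2))
    (r := @aligned s n) (S := sum_max_weight gamma s) G2 _ _ _ _ _)).
- exact: aligned_sym.
- move=> a b; rewrite negb_and negbK.
  have [a20 _|a20 /= ab] := eqVneq a.2 finset.set0.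
    by apply: inner0 => z; rewrite /G a20 eqxx.
  have [b20|b20] := eqVneq b.2 finset.set0.
    by rewrite innerC; apply: inner0 => z; rewrite /G b20 eqxx.
  move: ab; rewrite finset.eqEsubset negb_and /G (negbTE a20) (negbTE b20).
  move=> /orP[ab|ba].
    by apply: (inner_components0 nuT mu_box F2 gE L2_anova _ _ ab);
      exact: toeplitz_index_inj.
  by rewrite innerC; apply: (inner_components0 nuT mu_box F2 gE L2_anova _ _ ba);
    exact: toeplitz_index_inj.
- by [].
- by move=> a; exact: sum_aligned_le.
- move=> a /anova_null a0'.
  have [a20|a20] := eqVneq a.2 finset.set0.
    by apply: inner0 => z; rewrite /G a20 eqxx.
  rewrite innerG// /N /inner /Rintegral.
  by under eq_integral do rewrite -expr2; rewrite a0'.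
apply: ler_wpM2l => //.
rewrite -(pair_big xpredT xpredT (fun i u => (gamma (indices u))^-1 *
  inner (mu (n + s - 1)) (G (i, u)) (G (i, u))))/=.
apply: (@le_trans _ _ (\sum_(i < n) 1)); last first.
  by rewrite sumr_const card_ord.
apply: ler_sum => i _; apply: le_trans anova_norm_inner.
apply: ler_sum => u _.
have [u0|u0] := eqVneq u finset.set0; last by rewrite innerG.
rewrite (@inner0 _ _ _ _ (G (i, u))) ?mulr0 => [|z]; last by rewrite /G /= u0 eqxx.
by rewrite mulr_ge0 ?invr_ge0// /N inner_ge0.
Qed.

(** The ANOVA terms of f over all subsets sum to f itself. *)
Lemma toeplitz_errorE (z : (n + s - 1).-tuple R) :
  (forall k, Omega (tnth z k)) ->
  n%:R^-1 * \sum_(i < n) f (toeplitz_point (tnth z) i) - fine (I_rho Omega rho f) =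
  n%:R^-1 * \sum_a G a z.
Proof.
move=> zO.
have fE x : Omega_pow Omega x -> f x =
    \sum_(u : {set 'I_s} | u != finset.set0) g u x + fine (I_rho Omega rho f).
  move=> xO; have := gE finset.setT x.
  rewrite (eq_bigl xpredT) => [|u]; last by rewrite finset.subsetT.
  have -> : cond_mean mu (f \o @retract R Omega a0 s) finset.setT x = f x.
    transitivity (\int[mu s]_(y in setT) f x).
      apply: eq_Rintegral => y _ /=; congr f; apply: eq_from_tnth => i.
      by rewrite !tnth_mktuple finset.in_setT /retract1 mem_set//; exact: xO.
    rewrite Rintegral_cst// [X in fine X](_ : _ = 1%E) ?mulr1//.
    exact: probability_setT.
  by rewrite (bigD1 finset.set0)//= /g /= anova_set0 addrC => <-.
have nE : n%:R != 0 :> R by rewrite pnatr_eq0 -lt0n.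
have -> : \sum_(i < n) f (toeplitz_point (tnth z) i) =
    \sum_a G a z + n%:R * fine (I_rho Omega rho f).
  transitivity (\sum_(i < n) (\sum_u G (i, u) z + fine (I_rho Omega rho f))).
    apply: eq_bigr => i _.
    rewrite (_ : toeplitz_point _ i = select (toeplitz_index i) z); last first.
      by apply: eq_from_tnth => j; rewrite !tnth_mktuple.
    rewrite fE; last by move=> j; rewrite tnth_mktuple.
    congr (_ + _); rewrite big_mkcond; apply: eq_bigr => u _.
    by rewrite /G /=; case: eqP.
  rewrite big_split/= sumr_const card_ord mulr_natl; congr (_ + _).
  by rewrite pair_big; apply: eq_bigr => -[].
by rewrite mulrDr mulKf// addrK.
Qed.

Context d (T : measurableType d) (P : probability T R).
Context (X : 'I_(n + s - 1) -> {RV P >-> R}).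
Hypothesis iidX : iid_sample Omega rho X.

Lemma tmc_mean_square_error :
  ('E_P[fun w => ((n%:R^-1 *
      \sum_(i < n) f (toeplitz_point (fun k => X k w) i)
      - fine (I_rho Omega rho f)) ^+ 2)%R]
    <= (sum_max_weight gamma s / n%:R)%:E)%E.
Proof.
pose H z := \sum_a G a z.
have H2 : L2 (mu (n + s - 1)) H by exact: L2_sum.
have mX := measurable_sample X.
have XP := sample_law rho_dens muE iidX.
have E w : (n%:R^-1 * \sum_(i < n) f (toeplitz_point (fun k => X k w) i)
      - fine (I_rho Omega rho f)) ^+ 2 =
    n%:R^-1 ^+ 2 * (H (sample X w) * H (sample X w)).
  rewrite -expr2 -exprMn; congr (_ ^+ 2).
  rewrite -toeplitz_errorE; last first.
    by move=> k; rewrite tnth_mktuple; case: iidX.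
  congr (_ * _ - _); apply: eq_bigr => i _; congr f.
  by apply: eq_from_tnth => j; rewrite !tnth_mktuple.
rewrite unlock; under eq_integral do rewrite E EFinM.
have HX2 : L2 P (H \o sample X) by exact: (L2_transport mX XP).
rewrite integralZl//; last exact: (L2_mul_integrable HX2 HX2).
have -> : (\int[P]_x (H (sample X x) * H (sample X x))%:E)%E =
    (inner (mu (n + s - 1)) H H)%:E.
  rewrite -(inner_transport mX XP); [|by case: H2..].
  by rewrite inner_EFin.
rewrite -EFinM lee_fin.
apply: (le_trans (ler_wpM2l _ toeplitz_variance_le)).
  by rewrite exprn_ge0// invr_ge0.
rewrite le_eqVlt; apply/orP; left; apply/eqP; field.
by rewrite pnatr_eq0 -lt0n.
Qed.

End mean_square_error.

(** * Tractability *)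

Section tractability.
Context (R : realType) (Omega : set R) (rho : R -> R).
Context d (T : measurableType d) (P : probability T R).
Context (X : forall s N : nat, 'I_(N + s - 1) -> {RV P >-> R}).
Arguments X : clear implicits.
Context (gamma : set nat -> R).
Hypothesis rho_dens : is_density Omega rho.
Hypothesis iidX : forall s N : nat, (0 < s)%N -> (0 < N)%N ->
  iid_sample Omega rho (X s N).
Hypothesis gamma0 : forall u, 0 <= gamma u.

Local Notation S s := (sum_max_weight gamma s).

Lemma sum_max_weight_ge0 s : 0 <= S s.
Proof. by apply: sumr_ge0 => l _; exact: bigmax_ge_id. Qed.

Lemma sq_error_tmc_le s n : (0 < s)%N -> (0 < n)%N ->
  (sq_error Omega rho gamma P (tmc X) s n <= (S s / n%:R)%:E)%E.
Proof.
move=> s0 n0; apply: ge_ereal_sup => _ [f [fW f1] <-].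
have [mu muE] := rho_tuple_power rho_dens.
have [a0 Oa0] : exists a, Omega a.
  apply/set0P/eqP => O0; case: rho_dens => _ _ _.
  by rewrite O0 integral_set0 => /esym/eqP; rewrite onee_eq0.
exact: (tmc_mean_square_error rho_dens muE Oa0 gamma0 fW f1 n0 (iidX s0 n0)).
Qed.

(** The smallest integer greater than S / eps^2 is a sufficient number of
    points. *)
Lemma complexity_tmc_le s (eps : R) : (0 < s)%N -> 0 < eps ->
  (complexity Omega rho gamma P (tmc X) eps s <= (1 + S s * eps ^- 2)%:E)%E.
Proof.
move=> s0 e0; pose x := S s * eps ^- 2.
have x0 : 0 <= x by rewrite mulr_ge0 ?sum_max_weight_ge0// invr_ge0 exprn_ge0// ltW.
have /andP[nx xn] := truncn_itv x0.
apply: (@le_trans _ _ ((Num.truncn x).+1%:R)%:E); last first.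
  by rewrite lee_fin -natr1 addrC lerD2l.
apply: ereal_inf_lbound; exists (Num.truncn x).+1 => //; split => //.
apply: le_trans (sq_error_tmc_le s0 _) _ => //.
rewrite lee_fin ler_pdivrMr// -ler_pdivrMl ?exprn_gt0// mulrC; exact: ltW.
Qed.

Lemma complexity_ge1 (alg : forall s, nat -> (s.-tuple R -> R) -> T -> R) eps s :
  (1 <= complexity Omega rho gamma P alg eps s)%E.
Proof.
by apply: le_ereal_inf_tmp => _ [n [n0 _] <-]; rewrite lee_fin ler1n.
Qed.

Lemma tmc_polynomial_bound (C q : R) : 0 <= C -> 0 <= q ->
  (forall s, (0 < s)%N -> S s <= C * s%:R `^ q) ->
  polynomial_bound Omega rho gamma P (tmc X) 2 q.
Proof.
move=> C0 q0 SC; exists (1 + C); first by rewrite addr_ge0.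
move=> s eps s0 /andP[e0 e1].
apply: le_trans (complexity_tmc_le s0 e0) _.
have -> : eps `^ (- 2) = eps ^- 2 by rewrite powRN powR_mulrn// ltW.
have e2 : 1 <= eps ^- 2.
  by rewrite invf_ge1 ?exprn_gt0// exprn_ile1// ltW.
have sq : 1 <= (s%:R : R) `^ q.
  by rewrite -[leLHS](@powRr0 _ (s%:R : R)) ler_powR// ler1n.
rewrite lee_fin -mulrA [_ * s%:R `^ q]mulrC mulrA mulrDl mul1r mulrDl lerD//.
  by rewrite -[leLHS]mulr1 ler_pM.
by rewrite ler_wpM2r ?SC// (le_trans ler01).
Qed.

Lemma max_weight_le_sup s (l : 'I_s) :
  ((max_weight gamma l)%:E <= sup_weight gamma l.+1)%E.
Proof.
have ge u : u l.+1 -> (forall j, u j -> (l.+1 <= j)%N) ->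
    ((gamma u)%:E <= sup_weight gamma l.+1)%E.
  by move=> ul umin; apply: ereal_sup_ubound; exists u.
have := ge [set l.+1] erefl (fun j jl => eq_leq (esym jl)).
move: ge; case: (sup_weight gamma l.+1) => [r| |] ge; last 2 first.
- by move=> _; exact: leey.
- by rewrite leeNy_eq.
rewrite lee_fin => gr; rewrite lee_fin; apply: bigmax_le.
  exact: le_trans gr.
move=> u /andP[lu /forall_inP lmin]; rewrite -lee_fin; apply: ge.
  by exists l.
by move=> _ [j ju <-]; rewrite ltnS; exact: lmin.
Qed.

Lemma sum_max_weight_le_series s :
  ((S s)%:E <= \sum_(1 <= l <oo) sup_weight gamma l)%E.
Proof.
apply: (@le_trans _ _ (\sum_(1 <= l < s.+1) sup_weight gamma l)%E).
  rewrite big_add1 big_mkord -sumEFin; apply: lee_sum => l _.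
  exact: max_weight_le_sup.
apply: nneseries_lim_ge => l _ _.
apply: (@le_trans _ _ (gamma [set l])%:E); first by rewrite lee_fin.
by apply: ereal_sup_ubound; exists [set l] => //; split => // j ->.
Qed.

Lemma tmc_polynomially_tractable :
  (exists q : R, 0 < q /\
     (ereal_sup [set (S s / s%:R `^ q)%:E | s in [set s | (0 < s)%N]] < +oo)%E) ->
  polynomially_tractable Omega rho gamma P (tmc X) 2.
Proof.
move=> [q [q0]]; set sup := ereal_sup _ => supoo; split => //.
exists q; first exact: ltW.
have supP s : (0 < s)%N -> ((S s / s%:R `^ q)%:E <= sup)%E.
  by move=> s0; apply: ereal_sup_ubound; exists s.
have sup0 : (0 <= sup)%E.
  apply: le_trans (supP 1%N _) => //.
  by rewrite lee_fin divr_ge0// ?powR_ge0// sum_max_weight_ge0.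
apply: (@tmc_polynomial_bound (fine sup)); [exact: fine_ge0|exact: ltW|].
move=> s s0; rewrite -ler_pdivrMr ?powR_gt0 ?ltr0n//.
by rewrite -lee_fin fineK ?supP// ge0_fin_numE.
Qed.

Lemma tmc_strongly_polynomially_tractable :
  (\sum_(1 <= l <oo) sup_weight gamma l < +oo)%E ->
  strongly_polynomially_tractable Omega rho gamma P (tmc X) 2.
Proof.
move=> oo; split => //.
have ge0 : (0 <= \sum_(1 <= l <oo) sup_weight gamma l)%E.
  by apply: le_trans (sum_max_weight_le_series 0); rewrite lee_fin sum_max_weight_ge0.
apply: (@tmc_polynomial_bound (fine (\sum_(1 <= l <oo) sup_weight gamma l)%E)) => //.
  exact: fine_ge0.
move=> s _; rewrite powRr0 mulr1 -lee_fin fineK ?ge0_fin_numE//.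
exact: sum_max_weight_le_series.
Qed.

(** ln (eta t) <= eta t. *)
Lemma ln_affine_bound (eta t : R) : 0 < eta -> 0 < t -> ln t <= eta * t - ln eta.
Proof.
move=> eta0 t0; rewrite -lerBlDr opprK addrC -lnM ?posrE//.
by apply: ltW; apply: ln_sublinear; rewrite mulr_gt0.
Qed.

(** The constant B absorbs the finitely many s for which the limit says
    nothing. *)
Lemma sum_max_weight_subexponential (delta : R) : 0 < delta ->
  ((s%:R^-1)%:E * lne (S s)%:E)%E @[s --> \oo] --> 0%E ->
  exists2 B, 1 <= B & forall s, (0 < s)%N -> S s <= B * expR (delta * s%:R).
Proof.
move=> d0 Slim.
have nb : nbhs 0%E [set x : \bar R | (x < delta%:E)%E].
  by apply: open_ereal_lt'; rewrite lte_fin.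
have [s0 _ s0P] := Slim _ nb.
exists (1 + \sum_(i < s0) S i).
  by rewrite lerDl sumr_ge0// => i _; exact: sum_max_weight_ge0.
move=> s sgt0.
have B0 : 0 <= \sum_(i < s0) S i.
  by apply: sumr_ge0 => i _; exact: sum_max_weight_ge0.
have ds0 : 0 <= delta * s%:R by rewrite mulr_ge0// ltW.
have e1 : 1 <= expR (delta * s%:R) by rewrite -[leLHS](@expR0 R) ler_expR.
have [ss0|s0s] := ltnP s s0.
  apply: (@le_trans _ _ (\sum_(i < s0) S i)).
    rewrite (bigD1 (Ordinal ss0))//= lerDl sumr_ge0// => i _.
    exact: sum_max_weight_ge0.
  apply: (@le_trans _ _ (1 + \sum_(i < s0) S i)); first by rewrite lerDr.
  by rewrite -[leLHS]mulr1 ler_pM// addr_ge0.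
have := s0P s s0s; have [S0 _|S0] := leP (S s) 0.
  by apply: (le_trans S0); rewrite mulr_ge0 ?expR_ge0// addr_ge0.
rewrite /= (lt_geF S0) -EFinM lte_fin mulrC ltr_pdivrMr ?ltr0n// => lnS.
apply: (@le_trans _ _ (expR (delta * s%:R))).
  by rewrite -[leLHS](lnK (x := S s)) ?posrE// ler_expR ltW.
by rewrite -[leLHS]mul1r ler_pM// lerDl.
Qed.

(** With t = 1 / eps, the number of points is at most
    1 + S t^2 <= 2 B exp (delta s / 4) t^2; by [ln_affine_bound], 2 ln t costs
    another delta t / 4 and a constant, which is less than delta (t + s) / 2 for
    t + s large. *)
Lemma tmc_weakly_tractable :
  ((s%:R^-1)%:E * lne (S s)%:E)%E @[s --> \oo] --> 0%E ->
  weakly_tractable Omega rho gamma P (tmc X).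
Proof.
move=> Slim delta d0.
have d4 : 0 < delta / 4 by rewrite divr_gt0.
have d8 : 0 < delta / 8 by rewrite divr_gt0.
have [B B1 SB] := sum_max_weight_subexponential d4 Slim.
have B0 : 0 < B by exact: lt_le_trans B1.
pose D := ln (2 * B) - 2 * ln (delta / 8).
exists (2 * `|D| / delta) => s eps s0 /andP[e0 e1].
set t := eps^-1 => Mt.
have t1 : 1 <= t by rewrite invf_ge1// ltW.
have t0 : 0 < t by exact: lt_le_trans t1.
have ts0 : 0 < t + s%:R by rewrite addr_gt0// ltr0n.
pose K := 1 + S s * eps ^- 2.
have cK := complexity_tmc_le s0 e0; rewrite -/K in cK.
have c1 := complexity_ge1 (tmc X) eps s.
have K1 : 1 <= K.
  by rewrite lerDl mulr_ge0 ?sum_max_weight_ge0// invr_ge0 exprn_ge0// ltW.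
have K0 : 0 < K by exact: lt_le_trans K1.
have lnK_le : ln K <= D + delta / 4 * (t + s%:R).
  apply: (@le_trans _ _ (ln (2 * B * expR (delta / 4 * s%:R) * t ^+ 2))).
    rewrite ler_ln ?posrE//; last by rewrite !mulr_gt0 ?expR_gt0 ?exprn_gt0.
    have e1' : 1 <= expR (delta / 4 * s%:R).
      by rewrite -[leLHS](@expR0 R) ler_expR mulr_ge0// ltW.
    have t21 : 1 <= t ^+ 2 by rewrite exprn_ege1.
    have BE1 : 1 <= B * expR (delta / 4 * s%:R) by rewrite -[leLHS]mulr1 ler_pM.
    have BEt : 1 <= B * expR (delta / 4 * s%:R) * t ^+ 2.
      by rewrite -[leLHS]mulr1 ler_pM.
    have -> : 2 * B * expR (delta / 4 * s%:R) * t ^+ 2 =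
      B * expR (delta / 4 * s%:R) * t ^+ 2 + B * expR (delta / 4 * s%:R) * t ^+ 2.
      by ring.
    rewrite /K lerD// -exprVn ler_wpM2r ?exprn_ge0 ?(ltW t0)//.
    exact: SB.
  rewrite lnM ?posrE ?mulr_gt0 ?expR_gt0 ?exprn_gt0//.
  rewrite lnM ?posrE ?mulr_gt0 ?expR_gt0// expRK lnXn//.
  have := ln_affine_bound d8 t0; rewrite /D mulr2n; lra.
have Dlt : D < delta / 2 * (t + s%:R).
  apply: (le_lt_trans (ler_norm _)).
  move: Mt; rewrite ltr_pdivrMr//; lra.
move: c1 cK; case: (complexity _ _ _ _ _ _ _) => [c| |] //.
rewrite !lee_fin => c1 cK; have c0 : 0 < c by exact: lt_le_trans c1.
rewrite lne_EFin// -EFinM abse_EFin lte_fin ger0_norm; last first.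
  by rewrite divr_ge0 ?ln_ge0// ltW.
rewrite ltr_pdivrMr//; apply: (@le_lt_trans _ _ (ln K)).
  by rewrite ler_ln ?posrE.
apply: (le_lt_trans lnK_le).
have : 0 < delta * (t + s%:R) by rewrite mulr_gt0.
move: Dlt; lra.
Qed.

End tractability.

Theorem theorem2 (R : realType) (Omega : set R) (rho : R -> R)
    (d : measure_display) (T : measurableType d) (P : probability T R)
    (X : forall s N : nat, 'I_(N + s - 1) -> {RV P >-> R})
    (gamma : set nat -> R) :
  is_density Omega rho ->
  (forall s N : nat, (0 < s)%N -> (0 < N)%N ->
     iid_sample Omega rho (X s N)) ->
  (forall u : set nat, 0 <= gamma u) ->
  [/\ ((s%:R^-1)%:E * lne (sum_max_weight gamma s)%:E)%E @[s --> \oo] --> 0%E ->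
        weakly_tractable Omega rho gamma P (tmc X),
      (exists q : R, 0 < q /\
         (ereal_sup [set (sum_max_weight gamma s / s%:R `^ q)%:E
                    | s in [set s | (0 < s)%N]] < +oo)%E) ->
        polynomially_tractable Omega rho gamma P (tmc X) 2 &
      (\sum_(1 <= l <oo) sup_weight gamma l < +oo)%E ->
        strongly_polynomially_tractable Omega rho gamma P (tmc X) 2].
Proof.
move=> rho_dens iidX gamma0; split.
- exact: (tmc_weakly_tractable rho_dens iidX gamma0).
- exact: (tmc_polynomially_tractable rho_dens iidX gamma0).
- exact: (tmc_strongly_polynomially_tractable rho_dens iidX gamma0).
Qed.
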